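(* Consider a run of the decentralized Dykstra algorithm (described in the context) for the problem $\min_{x\in X^{|\mathcal V|}}\frac12\|x-x_0\|^2+\sum_{\alpha\in\mathcal E\cup\mathcal V}h_\alpha(x)$, assumed to be feasible. Assume that for all $n\ge 1$, $\mathcal E_n=\big[\bigcup_{w=1}^{\bar w}S_{n,w}\big]\cap\mathcal E$ and $\bigcup_{w=1}^{\bar w}S_{n,w}\supset\mathcal V$. Assume that there are constants $A$ and $B$ such that $$\sum_{\alpha\in\mathcal E\cup\mathcal V}\|z_\alpha^{n,\bar w}\|\le A\sqrt n+B\quad\text{for all }n\ge 1.$$ Then: (i) The sum $\sum_{n=1}^\infty\sum_{w=1}^{\bar w}\|v_A^{n,w}-v_A^{n,w-1}\|^2$ is finite, and $\{F(\{z_\alpha^{n,\bar w}\}_{\alpha\in\mathcal E\cup\mathcal V})\}_{n=1}^\infty$ is nondecreasing. (ii) There is a constant $C$ such that $\|v_A^{n,w}\|^2\le C$ for all $n\in\mathbb N$ and $w\in\{1,\dots,\bar w\}$. (iii) There exists a subsequence $\{v_A^{n_k,\bar w}\}_{k=1}^\infty$ of $\{v_A^{n,\bar w}\}_{n=1}^\infty$ which converges to some $v_A^*\in X^{|\mathcal V|}$ and such that $$\lim_{k\to\infty}\langle v_A^{n_k,\bar w}-v_A^{n_k,p(n_k,\alpha)},z_\alpha^{n_k,\bar w}\rangle=0\quad\text{for all }\alpha\in\mathcal E\cup\mathcal V.$$ (iv) For the $v_A^*$ in (iii), $x_0-v_A^*$ is the minimizer of the problem $\min_{x\in X^{|\mathcal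 V|}}\frac12\|x-x_0\|^2+h(x)$, where $h=\sum_{\alpha\in\mathcal E\cup\mathcal V}h_\alpha$, and $\lim_{k\to\infty}F(\{z_\alpha^{n_k,\bar w}\}_{\alpha\in\mathcal E\cup\mathcal V})=\frac12\|v_A^*\|^2+h(x_0-v_A^* )$. Consequently, $\lim_{n\to\infty}x^{n,\bar w}$ exists and equals $x_0-v_A^*$, the minimizer of the primal problem $\min_{x\in X^{|\mathcal V|}}\frac12\|x-x_0\|^2+\sum_{\alpha\in\mathcal E\cup\mathcal V}h_\alpha(x)$.
   Context: Setting. $X$ is a finite dimensional real Hilbert space and $(\mathcal V,\mathcal E)$ is a finite connected undirected graph. $X^{|\mathcal V|}$ has the product inner product, $\|x\|^2=\sum_{i\in\mathcal V}\langle x_i,x_i\rangle$, and $[z]_i$ is the $i$-th component of $z\in X^{|\mathcal V|}$. For $(i,j)\in\mathcal E$, $H_{(i,j)}=\{x\in X^{|\mathcal V|}:x_i=x_j\}$ and $h_{(i,j)}=\delta_{H_{(i,j)}}$ (indicator function: $0$ on the set, $+\infty$ off it). For $i\in\mathcal V$, $f_i:X\to\mathbb R\cup\{\infty\}$ is closed (lower semicontinuous) convex, and $h_i(x)=\mathbf f_i(x)=f_i(x_i)$. Fix $x_0\in X^{|\mathcal V|}$. $h_\alpha^*$ denotes the Fenchel conjugate of $h_\alpha$. The problem is feasible: there is $\hat x\in X$ with $f_i(\hat x)<\infty$ for all $i\in\mathcal V$. The dual objective function is $$F(\{z_\alpha\}_{\alpha\in\mathcal E\cup\mathcal V})=-\tfrac12\Big\|x_0-\sum_{\alpha\in\mathcal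 E\cup\mathcal V}z_\alpha\Big\|^2+\tfrac12\|x_0\|^2-\sum_{\alpha\in\mathcal E\cup\mathcal V}h_\alpha^*(z_\alpha),\qquad z_\alpha\in X^{|\mathcal V|}.$$ $D=\{x\in X^{|\mathcal V|}:x_i=x_j\ \forall i,j\in\mathcal V\}$, so $D^\perp=\{z:\sum_i z_i=0\}$. A subset $\mathcal E'\subset\mathcal E$ connects $\mathcal V$ if the graph $(\mathcal V,\mathcal E')$ is connected. Let $C_1>0$ be a constant such that for all $v\in D^\perp$ and all $\mathcal E'\subset\mathcal E$ connecting $\mathcal V$ there are $z_{(i,j)}\in H_{(i,j)}^\perp$, $(i,j)\in\mathcal E'$, with $\sum_{(i,j)\in\mathcal E'}z_{(i,j)}=v$ and $\|z_{(i,j)}\|\le C_1\|v\|$ (such a constant exists). Decentralized Dykstra algorithm. Let $\bar w$ be a positive integer. Start with $z_i^{1,0}\in X^{|\mathcal V|}$ ($i\in\mathcal V$) such that $[z_i^{1,0}]_j=0$ for $j\ne i$, and $v_H^{1,0}\in D^\perp$. For $n=1,2,\dots$: (1) Choose $\mathcal E_n\subset\mathcal E$ that connects $\mathcal V$. (2) Choose $\{z_{(i,j)}^{n,0}\}_{(i,j)\in\mathcal E}$ such that $z_{(i,j)}^{n,0}=0$ for $(i,j)\notin\mathcal E_n$; $z_{(i,j)}^{n,0}\in H_{(i,j)}^\perp$ and $\|z_{(i,j)}^{n,0}\|\le C_1\|v_H^{n,0}\|$ for all $(i,j)\in\mathcal E$; and $\sum_{(i,j)\in\mathcal E}z_{(i,j)}^{n,0}=v_H^{n,0}$.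 (3) For $w=1,\dots,\bar w$: choose a nonempty $S_{n,w}\subset\mathcal E_n\cup\mathcal V$; let $\{z_\alpha^{n,w}\}_{\alpha\in S_{n,w}}$ be a minimizer (assumed to exist) over $\{z_\alpha\}_{\alpha\in S_{n,w}}$ of $$\tfrac12\Big\|x_0-\sum_{\alpha\notin S_{n,w}}z_\alpha^{n,w-1}-\sum_{\alpha\in S_{n,w}}z_\alpha\Big\|^2+\sum_{\alpha\in S_{n,w}}h_\alpha^*(z_\alpha);$$ set $z_\alpha^{n,w}=z_\alpha^{n,w-1}$ for $\alpha\notin S_{n,w}$. (4) Set $z_i^{n+1,0}=z_i^{n,\bar w}$ for $i\in\mathcal V$ and $v_H^{n+1,0}=\sum_{(i,j)\in\mathcal E}z_{(i,j)}^{n,\bar w}$. Derived quantities, for $n\ge1$, $0\le w\le\bar w$: $v_H^{n,w}=\sum_{(i,j)\in\mathcal E}z_{(i,j)}^{n,w}$, $v_A^{n,w}=v_H^{n,w}+\sum_{i\in\mathcal V}z_i^{n,w}$, $x^{n,w}=x_0-v_A^{n,w}$. For $\alpha\in\mathcal E\cup\mathcal V$, $p(n,\alpha)=\max\{m\le\bar w:\alpha\in S_{n,m}\}$, with the convention $p(n,\alpha)=\bar w$ if $\alpha$ lies in no $S_{n,m}$, $1\le m\le\bar w$. *)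

(* Defs.v *)
From HB Require Import structures.
From mathcomp Require Import all_boot all_order all_algebra.
From mathcomp Require Import all_classical all_reals all_analysis.

Set Implicit Arguments.
Unset Strict Implicit.
Unset Printing Implicit Defensive.

Import Order.TTheory GRing.Theory Num.Theory.
Import numFieldNormedType.Exports.

Local Open Scope classical_set_scope.
Local Open Scope ring_scope.

(* A finite dimensional Hilbert space is a [finDimNormedType] together with a
   [{dot X for idfun}] form inducing its norm, see [induces_norm].  *)
#[short(type="finDimNormedType")]
HB.structure Definition FinDimNormed (R : realType) :=
  {X of NormedModule R X & Vector R X}.

Definition induces_norm (R : realType) (X : finDimNormedType R)
    (ip : {dot X for idfun}) : Prop :=
  forall x : X, `|x| ^+ 2 = ip x x.

(* The value -oo is excluded; properness is not required. *)
Definition closed_convex (R : realType) (X : finDimNormedType R)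
    (f : X -> \bar R) : Prop :=
  [/\ forall x, f x != -oo%E,
      lower_semicontinuous f &
      forall (t : R) (x y : X), 0 < t < 1 ->
        (f (t *: x + (1 - t) *: y)%R <= t%:E * f x + (1 - t)%:E * f y)%E].

Definition is_minimizer (R : realType) (T : Type) (g : T -> \bar R) (x : T) :
    Prop :=
  forall y, (g x <= g y)%E.

Definition is_the_minimizer (R : realType) (T : Type) (g : T -> \bar R)
    (x : T) : Prop :=
  is_minimizer g x /\ forall y, is_minimizer g y -> y = x.

Section ProductSpace.
Context (R : realType) (X : finDimNormedType R) (ip : {dot X for idfun}).
Context (V : finType).
Implicit Types x y z : {ffun V -> X}.

Definition ipV x y : R := \sum_(i : V) ip (x i) (y i).

Definition normV x : R := Num.sqrt (ipV x x).

Definition norm_cvg (u : nat -> {ffun V -> X}) (l : {ffun V -> X}) : Prop :=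
  (fun n => normV (u n - l)) @ \oo --> (0 : R).

Definition perp (A : set {ffun V -> X}) : set {ffun V -> X} :=
  [set z | forall x, A x -> ipV x z = 0].

Definition consensus : set {ffun V -> X} := [set x | forall i j, x i = x j].

(* The indicator function of convex analysis, not the {0,1}-valued one. *)
Definition indicator (A : set {ffun V -> X}) x : \bar R :=
  if x \in A then 0%E else +oo%E.

Definition fenchel_conjugate (h : {ffun V -> X} -> \bar R) z : \bar R :=
  ereal_sup [set ((ipV z x)%:E - h x)%E | x in [set: {ffun V -> X}]].

End ProductSpace.

(* An undirected graph is given by its set of edges, which are unordered pairs
   of distinct vertices. *)
Definition simple_graph (V : finType) (E : {set {set V}}) : Prop :=
  forall e, e \in E -> #|e| = 2%N.

Definition edge (V : finType) (E : {set {set V}}) : finType :=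
  {e : {set V} | e \in E}.

(* The disjoint union of the edges and the vertices. *)
Definition dual_index (V : finType) (E : {set {set V}}) : finType :=
  (edge E + V)%type.

Definition edge_rel (V : finType) (E : {set {set V}}) (E' : {set edge E}) :
    rel V :=
  fun i j => [exists e in E', val e == [set i; j]%SET].

Definition connects (V : finType) (E : {set {set V}}) (E' : {set edge E}) :
    Prop :=
  forall i j : V, fingraph.connect (edge_rel E') i j.

Section Dykstra.
Context (R : realType) (X : finDimNormedType R) (ip : {dot X for idfun}).
Context (V : finType) (E : {set {set V}}).
Local Notation XV := {ffun V -> X}.

Definition edge_space (e : edge E) : set XV :=
  [set x | forall i j, i \in val e -> j \in val e -> x i = x j].

Definition summand (f : V -> X -> \bar R) (a : dual_index E) : XV -> \bar R :=
  match a with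
  | inl e => indicator (edge_space e)
  | inr i => fun x => f i (x i)
  end.

Definition hsum (f : V -> X -> \bar R) (x : XV) : \bar R :=
  (\sum_(a : dual_index E) summand f a x)%E.

Definition primal (f : V -> X -> \bar R) (x0 x : XV) : \bar R :=
  ((2^-1 * normV ip (x - x0) ^+ 2)%:E + hsum f x)%E.

Definition dualF (f : V -> X -> \bar R) (x0 : XV) (z : dual_index E -> XV) :
    \bar R :=
  ((- (2^-1 * normV ip (x0 - \sum_(a : dual_index E) z a) ^+ 2)
    + 2^-1 * normV ip x0 ^+ 2)%:E
   - \sum_(a : dual_index E) fenchel_conjugate ip (summand f a) (z a))%E.

(* Only the components [y a] with [a \in S] matter. *)
Definition block_objective (f : V -> X -> \bar R) (x0 : XV)
    (S : {set dual_index E}) (zold y : dual_index E -> XV) : \bar R :=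
  ((2^-1 * normV ip (x0 - \sum_(a | a \notin S) zold a
                        - \sum_(a in S) y a) ^+ 2)%:E
   + \sum_(a in S) fenchel_conjugate ip (summand f a) (y a))%E.

Definition decomposition_constant (C1 : R) : Prop :=
  0 < C1 /\
  forall (v : XV) (E' : {set edge E}), perp ip (@consensus R X V) v ->
    connects E' ->
    exists z : edge E -> XV,
      [/\ forall e, e \in E' -> perp ip (edge_space e) (z e),
          \sum_(e in E') z e = v &
          forall e, e \in E' -> normV ip (z e) <= C1 * normV ip v].

(* [z n w a] is z_a^{n,w}, [vH0 n] is v_H^{n,0}, [En n] is E_n and [S n w] is
   S_{n,w}; nothing is required of z outside 1 <= n and w <= wbar. *)
Record dykstra_run (f : V -> X -> \bar R) (x0 : XV) (C1 : R) (wbar : nat)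
    (vH0 : nat -> XV)
    (z : nat -> nat -> dual_index E -> XV) (En : nat -> {set edge E})
    (S : nat -> nat -> {set dual_index E}) : Prop := DykstraRun {
  run_wbar : (0 < wbar)%N;
  run_init_z : forall i j : V, j != i -> z 1%N 0%N (inr i) j = 0;
  run_init_vH : perp ip (@consensus R X V) (vH0 1%N);
  run_connects : forall n, (0 < n)%N -> connects (En n);
  run_restart_zero : forall n (e : edge E), (0 < n)%N -> e \notin En n ->
    z n 0%N (inl e) = 0;
  run_restart_perp : forall n (e : edge E), (0 < n)%N ->
    perp ip (edge_space e) (z n 0%N (inl e));
  run_restart_bound : forall n (e : edge E), (0 < n)%N ->
    normV ip (z n 0%N (inl e)) <= C1 * normV ip (vH0 n);
  run_restart_sum : forall n, (0 < n)%N ->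
    \sum_(e : edge E) z n 0%N (inl e) = vH0 n;
  run_block_nonempty : forall n w, (0 < n)%N -> (0 < w <= wbar)%N ->
    S n w != finset.set0;
  run_block_sub : forall n w (e : edge E), (0 < n)%N -> (0 < w <= wbar)%N ->
    inl e \in S n w -> e \in En n;
  run_block_min : forall n w, (0 < n)%N -> (0 < w <= wbar)%N ->
    is_minimizer (block_objective f x0 (S n w) (z n w.-1)) (z n w);
  run_block_keep : forall n w (a : dual_index E), (0 < n)%N ->
    (0 < w <= wbar)%N -> a \notin S n w -> z n w a = z n w.-1 a;
  run_next_z : forall n (i : V), (0 < n)%N ->
    z n.+1 0%N (inr i) = z n wbar (inr i);
  run_next_vH : forall n, (0 < n)%N ->
    vH0 n.+1 = \sum_(e : edge E) z n wbar (inl e)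
}.

Definition vH (z : nat -> nat -> dual_index E -> XV) (n w : nat) : XV :=
  \sum_(e : edge E) z n w (inl e).

Definition vA (z : nat -> nat -> dual_index E -> XV) (n w : nat) : XV :=
  vH z n w + \sum_(i : V) z n w (inr i).

Definition iterate (x0 : XV) (z : nat -> nat -> dual_index E -> XV)
    (n w : nat) : XV :=
  x0 - vA z n w.

Definition last_update (S : nat -> nat -> {set dual_index E}) (wbar n : nat)
    (a : dual_index E) : nat :=
  if [exists m : 'I_wbar, a \in S n m.+1]
  then (\max_(m < wbar | a \in S n m.+1) m.+1)%N else wbar.

(* The index k of the subsequence starts at 0. *)
Definition good_subsequence (S : nat -> nat -> {set dual_index E}) (wbar : nat)
    (z : nat -> nat -> dual_index E -> XV) (nk : nat -> nat) (vstar : XV) :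
    Prop :=
  [/\ forall k, (0 < nk k)%N,
      forall k l, (k < l)%N -> (nk k < nk l)%N,
      norm_cvg ip (fun k => vA z (nk k) wbar) vstar &
      forall a : dual_index E,
        (fun k => ipV ip (vA z (nk k) wbar
                          - vA z (nk k) (last_update S wbar (nk k) a))
                         (z (nk k) wbar a)) @ \oo --> (0 : R)].

End Dykstra.

(* Main.v *)
(* Every cycle increases the dual value by at least half the sum of the squared
   moves of v_A, and weak duality with a feasible point bounds the dual value,
   so these moves are square summable; the gap at a point y dominates
   1/2 |x^{n,w} - y|^2, which bounds the iterates.  Square summability makes
   sqrt n times the total move of cycle n small infinitely often, which absorbs
   the sqrt n growth of the z_a and gives the subsequence.

   A block minimizer satisfies h_a(x) + h_a^*(z_a) = <x, z_a> at the current x.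
   This needs only the direction h_a(x) <= h_a^**(x) of the biconjugate
   theorem, which follows from the existence of proximal points without
   separating the epigraph.  Along the subsequence the dual value is therefore
   1/2 |v_A|^2 plus values of the h_a at points converging to x_0 - v_A^*, up
   to an error tending to 0.  Lower semicontinuity and weak duality then give
   strong duality at x_0 - v_A^*, and the gap inequality turns convergence of
   the (monotone) dual values into convergence of the whole sequence. *)

Require Import Defs.
From HB Require Import structures.
From mathcomp Require Import all_boot all_order all_algebra.
From mathcomp Require Import all_classical all_reals all_analysis.
From mathcomp Require Import ring lra.

Set Implicit Arguments.
Unset Strict Implicit.
Unset Printing Implicit Defensive.

Import Order.TTheory GRing.Theory Num.Theory.
Import numFieldNormedType.Exports.

Local Open Scope classical_set_scope.
Local Open Scope ring_scope.

(** * The product Hilbert space *)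

Section InnerProduct.
Context (R : realType) (X : finDimNormedType R) (ip : {dot X for idfun}).
Context (V : finType).
Local Notation XV := {ffun V -> X}.
Local Notation "'[ x , y ]" := (ipV ip x y).
Implicit Types x y z : XV.

Lemma ipVC x y : '[x, y] = '[y, x].
Proof. by apply: eq_bigr => i _; rewrite (hermitian_subproof (x i)) expr0 mul1r. Qed.

Lemma ipVDl x y z : '[x + y, z] = '[x, z] + '[y, z].
Proof. by rewrite -big_split; apply: eq_bigr => i _; rewrite ffunE linearDl. Qed.

Lemma ipVZl (t : R) x y : '[t *: x, y] = t * '[x, y].
Proof. by rewrite mulr_sumr; apply: eq_bigr => i _; rewrite ffunE linearZl_LR. Qed.

Lemma ipVDr x y z : '[z, x + y] = '[z, x] + '[z, y].
Proof. by rewrite ipVC ipVDl !(ipVC z). Qed.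

Lemma ipVZr (t : R) x y : '[y, t *: x] = t * '[y, x].
Proof. by rewrite ipVC ipVZl ipVC. Qed.

Lemma ipVNl x y : '[- x, y] = - '[x, y].
Proof. by rewrite -scaleN1r ipVZl mulN1r. Qed.

Lemma ipVNr x y : '[y, - x] = - '[y, x].
Proof. by rewrite ipVC ipVNl ipVC. Qed.

Definition ipVE := (ipVDl, ipVDr, ipVNl, ipVNr, ipVZl, ipVZr).

Lemma ipV0l x : '[0, x] = 0.
Proof. by rewrite -(scale0r 0) ipVZl mul0r. Qed.

Lemma ipV0r x : '[x, 0] = 0.
Proof. by rewrite ipVC ipV0l. Qed.

Lemma ipV_sumr (I : finType) (P : pred I) (u : I -> XV) x :
  '[x, \sum_(i | P i) u i] = \sum_(i | P i) '[x, u i].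
Proof.
by apply: (big_morph (ipV ip x)); [move=> ? ?; exact: ipVDr|exact: ipV0r].
Qed.

Let ip_gt0 (a : X) : a != 0 -> 0 < ip a a.
Proof. exact: neq0_dnorm_gt0. Qed.

Let ip_ge0 (a : X) : 0 <= ip a a.
Proof. by have [->|/ip_gt0/ltW//] := eqVneq a 0; rewrite linear0l. Qed.

Lemma ipVxx_ge0 x : 0 <= '[x, x].
Proof. by apply: sumr_ge0. Qed.

Lemma ipVxx_eq0 x : '[x, x] = 0 -> x = 0.
Proof.
move=> /psumr_eq0P x0; apply/ffunP => i; rewrite ffunE; apply/eqP/negPn/negP.
by move=> /ip_gt0; rewrite x0 ?ltxx // => j _; exact: ip_ge0.
Qed.

Lemma normV_ge0 x : 0 <= normV ip x.
Proof. exact: sqrtr_ge0. Qed.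

Lemma normV_sqr x : normV ip x ^+ 2 = '[x, x].
Proof. by rewrite sqr_sqrtr // ipVxx_ge0. Qed.

Lemma normVZ (t : R) x : normV ip (t *: x) = `|t| * normV ip x.
Proof. by rewrite /normV ipVZl ipVZr mulrA -expr2 sqrtrM ?sqr_ge0 // sqrtr_sqr. Qed.

Lemma normVN x : normV ip (- x) = normV ip x.
Proof. by rewrite -scaleN1r normVZ normrN1 mul1r. Qed.

Lemma normV0 : normV ip (0 : XV) = 0.
Proof. by rewrite /normV ipV0l sqrtr0. Qed.

Lemma normV_distC x y : normV ip (x - y) = normV ip (y - x).
Proof. by rewrite -normVN opprB. Qed.

Lemma normV_sqrD x y :
  normV ip (x + y) ^+ 2 = normV ip x ^+ 2 + 2 * '[x, y] + normV ip y ^+ 2.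
Proof. by rewrite !normV_sqr !ipVE (ipVC y x); ring. Qed.

Lemma normV_sqrB x y :
  normV ip (x - y) ^+ 2 = normV ip x ^+ 2 - 2 * '[x, y] + normV ip y ^+ 2.
Proof. by rewrite normV_sqrD ipVNr normVN; ring. Qed.

(** Cauchy-Schwarz: expand the nonnegative square of [normV ip y *: x - normV ip x *: y] and divide
    by the product of the norms. *)
Lemma ipV_le_normM x y : '[x, y] <= normV ip x * normV ip y.
Proof.
have [y0|y0] := eqVneq (normV ip y) 0.
  have /ipVxx_eq0 -> : '[y, y] = 0 by rewrite -normV_sqr y0 expr0n.
  by rewrite ipV0r normV0 mulr0.
have {y0}ygt : 0 < normV ip y by rewrite lt0r y0 normV_ge0.
have := ipVxx_ge0 (normV ip y *: x - normV ip x *: y).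
rewrite -normV_sqr normV_sqrB ipVZl ipVZr !normVZ !ger0_norm ?normV_ge0 //.
have [x0|x0] := eqVneq (normV ip x) 0.
  have /ipVxx_eq0 -> : '[x, x] = 0 by rewrite -normV_sqr x0 expr0n.
  by move=> _; rewrite ipV0l normV0 mul0r.
have {x0}xgt : 0 < normV ip x by rewrite lt0r x0 normV_ge0.
have : 0 < normV ip x * normV ip y by rewrite mulr_gt0.
move: (normV ip x) (normV ip y) ('[x, y]) => a b c ab H.
rewrite -(ler_pM2l ab); lra.
Qed.

Lemma normr_ipV_le x y : `|'[x, y]| <= normV ip x * normV ip y.
Proof.
by rewrite ler_norml lerNl -ipVNl -{1}normVN !ipV_le_normM.
Qed.

Lemma ler_normVD x y : normV ip (x + y) <= normV ip x + normV ip y.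
Proof.
rewrite -ler_sqr ?nnegrE ?addr_ge0 ?normV_ge0 // normV_sqrD.
by have := ipV_le_normM x y; nra.
Qed.

Lemma ler_normVB x y z : normV ip (x - z) <= normV ip (x - y) + normV ip (y - z).
Proof. by apply: le_trans (ler_normVD _ _); rewrite addrA subrK. Qed.

Lemma ler_normV_sum (I : Type) (r : seq I) (P : pred I) (u : I -> XV) :
  normV ip (\sum_(i <- r | P i) u i) <= \sum_(i <- r | P i) normV ip (u i).
Proof.
elim/big_rec2: _ => [|i a b _ ab]; first by rewrite normV0.
by apply: le_trans (ler_normVD _ _) _; rewrite lerD2l.
Qed.

Definition gramf (b : seq XV) x : 'rV[R]_(size b) := \row_k '[x, b`_k].

Fact gramf_linear (b : seq XV) : linear (gramf b).
Proof. by move=> t x y; apply/rowP => k; rewrite !mxE ipVDl ipVZl. Qed.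

HB.instance Definition _ (b : seq XV) :=
  GRing.isLinear.Build R XV 'rV[R]_(size b) _ (gramf b) (gramf_linear b).

(** Pairing with a basis is injective, since a vector orthogonal to every basis vector is orthogonal
    to itself; the [c k] are the images of the unit rows under a left inverse. This reduces norm
    convergence to that of finitely many scalar sequences. *)
Lemma dual_frame : exists (m : nat) (b c : 'I_m -> XV),
  forall x, x = \sum_k '[x, b k] *: c k.
Proof.
pose b : seq XV := vbasis (@fullv R XV).
pose G : 'Hom(XV, 'rV[R]_(size b)) := linfun (gramf b).
have Ginj : lker G == 0%VS.
  apply/lker0P => x y; rewrite !lfunE /= => exy.
  apply/eqP; rewrite -subr_eq0; apply/eqP/ipVxx_eq0.
  set d := x - y.
  have db k : (k < size b)%N -> '[d, b`_k] = 0.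
    move=> kb; move/rowP/(_ (Ordinal kb)): exy; rewrite !mxE /d ipVDl ipVNl /=.
    by move=> ->; rewrite subrr.
  have -> : '[d, d] = '[d, \sum_i coord (vbasis fullv) i d *: (vbasis fullv)`_i].
    by congr (ipV _ _ _); apply: coord_vbasis; rewrite memvf.
  rewrite ipV_sumr big1 // => i _; rewrite ipVZr db ?mulr0 //.
  by rewrite /b size_tuple.
exists (size b), (fun k => b`_k), (fun k => (G^-1)%VF (delta_mx 0 k)) => x.
rewrite -[LHS](lker0_lfunK Ginj) lfunE /= [in LHS](row_sum_delta (gramf b x)).
by rewrite linear_sum; apply: eq_bigr => k _; rewrite linearZ mxE.
Qed.

End InnerProduct.

(** * Subsequences and convergence in norm *)

Lemma increasing_seq_ge (f : nat -> nat) : {homo f : k l / (k < l)%N} ->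
  forall k, (k <= f k)%N.
Proof. by move=> fi; elim=> // k IH; apply: leq_ltn_trans IH (fi _ _ _). Qed.

Lemma near_subseq (f : nat -> nat) (P : nat -> Prop) :
  {homo f : k l / (k < l)%N} ->
  (\forall n \near \oo, P n) -> \forall k \near \oo, P (f k).
Proof.
move=> fi [N _ NP]; exists N => // k /= Nk; apply: NP => /=.
exact: leq_trans Nk (increasing_seq_ge fi k).
Qed.

(** Successive extraction, one index of [s] at a time: refining a subsequence preserves the limits
    already obtained. *)
Lemma common_cvg_subseq (R : realType) (I : eqType) (s : seq I)
    (u : I -> nat -> R) (M : I -> R) :
  (forall i n, `|u i n| <= M i) ->
  exists2 f : nat -> nat, {homo f : k l / (k < l)%N} &
    forall i, i \in s -> cvgn (u i \o f).
Proof.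
move=> uM; elim: s => [|j s [f fi fs]]; first by exists id.
have /bolzano_weierstrass [g gi gc] : bounded_fun (u j \o f).
  exists (M j); split=> [|B /ltW MB n _]; first exact: num_real.
  exact: le_trans (uM _ _) MB.
have {}gi : {homo g : k l / (k < l)%N}.
  by move=> k l kl; suff : (g k < g l)%O by []; rewrite (leW_mono gi).
exists (f \o g) => [k l kl|i]; first exact/fi/gi.
rewrite inE => /predU1P[-> //|/fs fc].
have /cvg_ex[l ul] := fc; apply/cvg_ex; exists l.
move=> A /ul; exact: (near_subseq (P := fun n => A (u i (f n)))).
Qed.

Lemma cvg_sumr (R : realType) (I : finType) (u : I -> nat -> R) (l : I -> R) :
  (forall i, u i @ \oo --> l i) ->
  (fun n => \sum_i u i n) @ \oo --> \sum_i l i.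
Proof.
move=> ul; apply: cvg_big => [|i _]; [exact: add_continuous|exact: ul].
Qed.

Section NormConvergence.
Context (R : realType) (X : finDimNormedType R) (ip : {dot X for idfun}).
Context (V : finType).
Local Notation XV := {ffun V -> X}.
Implicit Types (u : nat -> XV) (x y l : XV).

Lemma norm_cvg_near u l : norm_cvg ip u l ->
  forall e, 0 < e -> \forall n \near \oo, normV ip (u n - l) < e.
Proof.
move=> /cvgrPdist_lt ul e /ul; apply: filterS => n.
by rewrite sub0r normrN ger0_norm ?normV_ge0.
Qed.

Lemma near_norm_cvg u l :
  (forall e, 0 < e -> \forall n \near \oo, normV ip (u n - l) <= e) ->
  norm_cvg ip u l.
Proof.
move=> ul; apply/cvgrPdist_le => e /ul; apply: filterS => n.
by rewrite sub0r normrN ger0_norm ?normV_ge0.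
Qed.

Lemma norm_cvg_squeeze (b : nat -> R) u l :
  (\forall n \near \oo, normV ip (u n - l) <= b n) -> b @ \oo --> 0 ->
  norm_cvg ip u l.
Proof.
move=> ub b0; apply: near_norm_cvg => e e0.
move/cvgrPdist_lt: b0 => /(_ e e0); apply: filterS2 ub => n ub.
rewrite sub0r normrN => be; apply: le_trans ub _; apply/ltW.
exact: le_lt_trans (ler_norm _) be.
Qed.

Lemma cvg_normV_sub u l y : norm_cvg ip u l ->
  (fun n => normV ip (u n - y)) @ \oo --> normV ip (l - y).
Proof.
move=> ul; apply/cvgrPdist_lt => e e0.
apply: filterS (norm_cvg_near ul e0) => n; apply: le_lt_trans.
have := ler_normVB ip l (u n) y; have := ler_normVB ip (u n) l y.
by rewrite (normV_distC _ l (u n)) ler_norml; lra.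
Qed.

Lemma norm_cvgN u l x : norm_cvg ip u l ->
  norm_cvg ip (fun n => x - u n) (x - l).
Proof.
apply: cvg_trans; apply: near_eq_cvg; apply: nearW => n.
have -> : x - u n - (x - l) = l - u n by rewrite opprB addrC addrA subrK.
by rewrite normV_distC.
Qed.

Lemma norm_cvgD u v l : norm_cvg ip u l ->
  (fun n => normV ip (v n - u n)) @ \oo --> 0 -> norm_cvg ip v l.
Proof.
move=> ul vu; have := cvgD vu ul; rewrite addr0 => uvl.
apply: (norm_cvg_squeeze _ (uvl _)); apply: nearW => n; exact: ler_normVB.
Qed.

(** The pairings with the [b k] are bounded by Cauchy-Schwarz, so they converge along a common
    subsequence; their limits, as coefficients of the [c k], rebuild the limit vector. *)
Lemma bolzano_weierstrass_ffun u (M : R) : (forall n, normV ip (u n) <= M) ->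
  exists f l, {homo f : k l / (k < l)%N} /\ norm_cvg ip (u \o f) l.
Proof.
move=> uM; have [m [b [c bcE]]] := dual_frame ip V.
have ub (k : 'I_m) n : `|ipV ip (u n) (b k)| <= M * normV ip (b k).
  by apply: le_trans (normr_ipV_le _ _ _) _; rewrite ler_wpM2r ?normV_ge0.
have [f fi fc] := common_cvg_subseq (enum 'I_m) ub.
pose t k := limn ((fun n => ipV ip (u n) (b k)) \o f).
exists f, (\sum_k t k *: c k); split => //.
apply: (@norm_cvg_squeeze
    (fun n => \sum_k `|ipV ip (u (f n)) (b k) - t k| * normV ip (c k))).
  apply: nearW => n /=; rewrite {1}[u (f n)]bcE -sumrB.
  apply: le_trans (ler_normV_sum _ _ _ _) _; apply: ler_sum => k _.
  by rewrite -scalerBl normVZ.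
have z0 : \sum_(k < m) 0 * normV ip (c k) = 0 by apply: big1 => k _; rewrite mul0r.
rewrite -[X in _ --> X]z0.
apply: cvg_sumr => k.
apply: cvgMr_tmp; apply/norm_cvg0P/subr_cvg0.
by apply: fc; rewrite mem_enum.
Qed.

End NormConvergence.

(** * Closed proper convex functions and their conjugates *)

Section ConvexFunction.
Context (R : realType) (X : finDimNormedType R) (ip : {dot X for idfun}).
Context (V : finType).
Local Notation XV := {ffun V -> X}.
Local Notation "'[ x , y ]" := (ipV ip x y).
Implicit Types (h : XV -> \bar R) (x y z u p q : XV).

(** Semicontinuity is sequential with respect to [normV], so no topology on the product space
    enters. *)
Definition closed_proper_convex h : Prop :=
  [/\ forall x, h x != -oo%E,
      exists x, (h x < +oo)%E,
      forall (u : nat -> XV) l c, norm_cvg ip u l -> (c%:E < h l)%E ->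
        \forall n \near \oo, (c%:E < h (u n))%E &
      forall (t : R) x y, 0 < t < 1 ->
        (h (t *: x + (1 - t) *: y)%R <= t%:E * h x + (1 - t)%:E * h y)%E].

Lemma convex_le h (t a b : R) x y : closed_proper_convex h -> 0 < t <= 1 ->
  (h x <= a%:E)%E -> (h y <= b%:E)%E ->
  (h (t *: x + (1 - t) *: y)%R <= (t * a + (1 - t) * b)%:E)%E.
Proof.
move=> [_ _ _ cvx] /andP[t0]; rewrite le_eqVlt => /predU1P[->|t1] hx hy.
  by rewrite subrr scale1r scale0r addr0 mul1r mul0r addr0.
apply: (le_trans (cvx t x y _)); first by rewrite t0.
rewrite [leRHS]EFinD !EFinM; apply: leeD; apply: lee_wpmul2l => //.
  by rewrite lee_fin ltW.
by rewrite lee_fin subr_ge0 ltW.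
Qed.

(** An affine minorant of slope [z] leaves [h x] alone on one side, so infinite values of [h] need
    no extended subtraction. *)
Lemma fenchel_conjugate_leP h z (c : R) :
  (fenchel_conjugate ip h z <= c%:E)%E <->
  forall x, (('[z, x] - c)%:E <= h x)%E.
Proof.
have aux x : (('[z, x])%:E - h x <= c%:E)%E = (('[z, x] - c)%:E <= h x)%E.
  case: (h x) => [r| |] //=; rewrite ?leNye ?leey //.
  by rewrite !lee_fin lerBlDr lerBlDl.
split=> [H x|H].
  by rewrite -aux; apply: le_trans H; apply: ereal_sup_ubound; exists x.
by apply: ge_ereal_sup => _ [x _ <-]; rewrite aux.
Qed.

Lemma ipV_sub_le_fenchel_conjugate h z x :
  ('[z, x]%:E - h x <= fenchel_conjugate ip h z)%E.
Proof. by apply: ereal_sup_ubound; exists x. Qed.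

Lemma fenchel_conjugate_gt_ninfty h z : closed_proper_convex h ->
  fenchel_conjugate ip h z != -oo%E.
Proof.
move=> [hN [x hx] _ _]; have := ipV_sub_le_fenchel_conjugate h z x.
case: (h x) (hN x) hx => [r| |] // _ _; apply: contraTneq => ->.
by rewrite -ltNge ltNyr.
Qed.

Lemma bounded_subseq_lsc h (y : nat -> XV) (M : R) : closed_proper_convex h ->
  (forall n, normV ip (y n) <= M) ->
  exists (f : nat -> nat) l, [/\ {homo f : k l / (k < l)%N},
    norm_cvg ip (y \o f) l &
    forall c : R, (c%:E < h l)%E -> \forall k \near \oo, (c%:E < h (y (f k)))%E].
Proof.
move=> [_ _ hlsc _] /bolzano_weierstrass_ffun[f [l [fi fl]]].
by exists f, l; split=> // c; exact: hlsc.
Qed.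

(** By compactness: points of the ball with [h] tending to -oo would accumulate at some [l], near
    which lower semicontinuity and [h l != -oo] bound [h] from below. *)
Lemma le_lbound_ball h x : closed_proper_convex h ->
  exists m : R, forall y, normV ip (y - x) <= 1 -> (m%:E <= h y)%E.
Proof.
move=> hcpc; apply: contrapT => /forallNP noM.
have /choice[y yP] : forall n : nat, exists y,
    normV ip (y - x) <= 1 /\ (h y < (- n%:R)%:E)%E.
  move=> n; have /existsNP[y /not_implyP[y1 /negP]] := noM (- n%:R).
  by rewrite -ltNge => hy; exists y.
have yb n : normV ip (y n) <= 1 + normV ip x.
  rewrite -{1}[y n](subrK x); apply: le_trans (ler_normVD _ _ _) _.
  by rewrite lerD2r (yP n).1.
have [f [l [fi _ flsc]]] := bounded_subseq_lsc hcpc yb.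
have [c cl] : exists c : R, (c%:E < h l)%E.
  case: hcpc => /(_ l); case: (h l) => [r| |] // _ _ _ _.
    by exists (r - 1); rewrite lte_fin gtrBl.
  by exists 0; rewrite ltry.
have [N _ NP] := flsc c cl.
have [k Nk ck] : exists2 k, (N <= k)%N & - c <= k%:R.
  exists (maxn N (Num.bound `|c|)); first exact: leq_maxl.
  apply: (@le_trans _ _ `|c|); first by rewrite -normrN ler_norm.
  by apply: le_trans (ltW (archi_boundP _)) _; rewrite ?ler_nat ?leq_maxr.
have := lt_trans (NP k Nk) (yP (f k)).2; rewrite lte_fin ltNge => /negP; apply.
rewrite lerNl; apply: le_trans ck _; rewrite ler_nat.
exact: increasing_seq_ge.
Qed.

End ConvexFunction.

(** * Proximal points and subgradients *)

(** A limit [t -> 0] made explicit: for negative [a] the chosen [t] gives [t * d <= - a / 2], so the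
    sum stays negative. It extracts first-order optimality conditions. *)
Lemma ge0_of_affine_ge0 (R : realFieldType) (a d : R) :
  (forall t, 0 < t <= 1 -> 0 <= a + t * d) -> 0 <= a.
Proof.
move=> H; rewrite leNgt; apply/negP => a0.
have D0 : 0 < `|d| + 1 by rewrite ltr_wpDl.
pose t := Num.min 1 (- a / (2 * (`|d| + 1))).
have t0 : 0 < t by rewrite lt_min ltr01 divr_gt0 ?oppr_gt0 // mulr_gt0.
have := H t; rewrite t0 ge_min lexx => /(_ isT).
have : t * (2 * (`|d| + 1)) <= - a.
  by rewrite -ler_pdivlMr ?mulr_gt0 // ge_min lexx orbT.
have := ler_norm d; nra.
Qed.

(** For larger [d], which then exceeds 1, the quadratic term outgrows [k + b * d]; this confines
    minimizing sequences. *)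
Lemma quadratic_sublevel (R : realFieldType) (d b k : R) :
  0 <= d -> 0 <= b -> 0 <= k -> 2^-1 * (d * d) <= k + b * d ->
  d <= 2 * b + 2 * k + 1.
Proof.
move=> d0 b0 k0 H; rewrite leNgt; apply/negP => dk.
have : 0 <= k * (d - 1) by rewrite mulr_ge0 //; lra.
have : 0 < (d - (2 * b + 2 * k + 1)) * d by rewrite mulr_gt0 //; lra.
lra.
Qed.

Section Subgradient.
Context (R : realType) (X : finDimNormedType R) (ip : {dot X for idfun}).
Context (V : finType).
Local Notation XV := {ffun V -> X}.
Local Notation "'[ x , y ]" := (ipV ip x y).
Implicit Types (h : XV -> \bar R) (x y z u p q c : XV).

(* A lower bound on a ball around [x] propagates along rays by convexity. *)
Lemma ge_affine_dist h x : closed_proper_convex ip h -> (h x < +oo)%E ->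
  exists a b : R, forall y, ((a - b * normV ip (y - x))%:E <= h y)%E.
Proof.
move=> hcpc hx; have [m0 mP] := le_lbound_ball x hcpc.
have [f0 hx0] : exists f0 : R, h x = f0%:E.
  by case: hcpc => /(_ x) + _ _ _; case: (h x) hx => [r| |] // _ _; exists r.
have mf : m0 <= f0 by rewrite -lee_fin -hx0 mP // subrr normV0.
exists m0, (f0 - m0) => y; set d := normV ip (y - x).
have d0 : 0 <= d by exact: normV_ge0.
have [d1|d1] := leP d 1.
  apply: le_trans (mP y d1); rewrite lee_fin; nra.
have dgt : 0 < d by lra.
case hy : (h y) => [r| |]; last 2 first.
- by rewrite leey.
- by case: hcpc => /(_ y); rewrite hy.
(* With weight [d^-1] on [y] the combination lies at distance 1 from [x], so the bound on the ball
   applies to it. *)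
have t01 : 0 < d^-1 <= 1 by rewrite invr_gt0 dgt invf_le1 // ltW.
have := @convex_le _ _ _ _ h d^-1 r f0 y x hcpc t01.
rewrite hy hx0 => /(_ (lexx _) (lexx _)).
have -> : d^-1 *: y + (1 - d^-1) *: x = x + d^-1 *: (y - x).
  by rewrite scalerBr scalerBl scale1r; rewrite addrCA addrA.
set w := x + _ => hw.
have : (m0%:E <= h w)%E.
  by apply: mP; rewrite /w addrC addKr normVZ gtr0_norm ?invr_gt0 // mulVf ?gt_eqF.
move=> /le_trans/(_ hw); rewrite !lee_fin.
rewrite -(ler_pM2l dgt) mulrDr mulrA mulfV ?gt_eqF // mul1r mulrA mulrBr.
by rewrite mulr1 mulfV ?gt_eqF //; nra.
Qed.

(** The direct method: the minorant of [ge_affine_dist] bounds the objective below and confines a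
    minimizing sequence, and lower semicontinuity passes to the limit. Quantifying over real bounds
    [s] keeps the inequality in the reals. *)
Lemma prox_exists h c : closed_proper_convex ip h ->
  exists p (r : R), h p = r%:E /\
    forall y (s : R), (h y <= s%:E)%E ->
      r + 2^-1 * normV ip (p - c) ^+ 2 <= s + 2^-1 * normV ip (y - c) ^+ 2.
Proof.
move=> hcpc; have [hN [x hx] _ _] := hcpc.
have [a0 [b abP]] := ge_affine_dist hcpc hx.
pose Q : set R := [set g | exists y s,
  (h y <= s%:E)%E /\ g = s + 2^-1 * normV ip (y - c) ^+ 2].
pose a := a0 - `|b| * normV ip (c - x).
have lowb y s : (h y <= s%:E)%E -> a - `|b| * normV ip (y - c) <= s.
  move=> hys; have := le_trans (abP y) hys; rewrite lee_fin; apply: le_trans.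
  have := ler_normVB ip y c x; have := ler_norm b; have := normr_ge0 b.
  have := normV_ge0 ip (y - x); rewrite /a; nra.
have Qlb : has_lbound Q.
  (* Completing the square in the distance of [y] from [c]. *)
  exists (a - 2^-1 * `|b| ^+ 2) => _ [y [s [/lowb hys ->]]].
  by have := sqr_ge0 (normV ip (y - c) - `|b|); nra.
have Q0 : Q !=set0.
  case hx' : (h x) hx => [r| |] // _; last by move: (hN x); rewrite hx'.
  by exists (r + 2^-1 * normV ip (x - c) ^+ 2), x, r; rewrite hx'.
pose mu := inf Q.
have muP y s : (h y <= s%:E)%E -> mu <= s + 2^-1 * normV ip (y - c) ^+ 2.
  by move=> hys; apply: ge_inf => //; exists y, s.
have /choice[y yP] : forall n : nat, exists y,
    (h y <= (mu + n.+1%:R^-1 - 2^-1 * normV ip (y - c) ^+ 2)%:E)%E.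
  move=> n; have n0 : 0 < n.+1%:R^-1 :> R by rewrite invr_gt0.
  have [_ [y [s [hys ->]]] ys] := inf_adherent n0 (conj Q0 Qlb).
  by exists y; apply: le_trans hys _; rewrite lee_fin lerBrDr ltW.
(* The error [n.+1%:R^-1] is at most 1, so all [y n] lie in the sublevel set of height [mu + 1]. *)
have yc n : normV ip (y n - c) <= 2 * `|b| + 2 * `|mu + 1 - a| + 1.
  have := lowb _ _ (yP n).
  have : n.+1%:R^-1 <= 1 :> R by rewrite invf_le1 // ler1n.
  move=> e1 H; apply: quadratic_sublevel => //; first exact: normV_ge0.
  have := ler_norm (mu + 1 - a); move: H e1; rewrite expr2.
  set e : R := n.+1%:R^-1. by lra.
have yb n : normV ip (y n) <= 2 * `|b| + 2 * `|mu + 1 - a| + 1 + normV ip c.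
  rewrite -[y n](subrK c); apply: le_trans (ler_normVD _ _ _) _.
  by rewrite lerD2r.
have [f [p [fi yp flsc]]] := bounded_subseq_lsc hcpc yb.
have cvgbd : (fun k => mu + (f k).+1%:R^-1 -
      2^-1 * (normV ip (y (f k) - c) * normV ip (y (f k) - c))) @ \oo -->
    mu + 0 - 2^-1 * (normV ip (p - c) * normV ip (p - c)).
  have c1 := cvg_normV_sub (y := c) yp.
  have c2 : (fun k => (f k).+1%:R^-1 : R) @ \oo --> (0 : R).
    by move=> A /(@cvg_harmonic R); exact: (near_subseq (P := fun n => A (harmonic n))).
  apply: cvgB; first by apply: cvgD => //; exact: cvg_cst.
  by apply: cvgMl_tmp; apply: cvgM.
have hp : (h p <= (mu - 2^-1 * normV ip (p - c) ^+ 2)%:E)%E.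
  (* Otherwise a real [s] lies strictly between; semicontinuity puts it below [h (y (f k))]
     eventually, hence below the bounds in [cvgbd] and at most their limit. *)
  rewrite leNgt; apply/negP => lthp.
  have [s ls hs] : exists2 s, mu - 2^-1 * normV ip (p - c) ^+ 2 < s & (s%:E < h p)%E.
    case: (h p) lthp (hN p) => [r| |] //.
      rewrite lte_fin => lr _; exists ((mu - 2^-1 * normV ip (p - c) ^+ 2 + r) / 2).
        by rewrite midf_lt.
      by rewrite lte_fin midf_lt.
    by move=> _ _; exists (mu - 2^-1 * normV ip (p - c) ^+ 2 + 1); rewrite ?ltrDl // ltry.
  have := ls; rewrite ltNge => /negP; apply.
  have -> : mu - 2^-1 * normV ip (p - c) ^+ 2 =
      mu + 0 - 2^-1 * (normV ip (p - c) * normV ip (p - c)).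
    by rewrite addr0 expr2.
  apply: (cvgr_to_ge cvgbd); apply: filterS (flsc s hs) => k sk.
  by have := lt_le_trans sk (yP (f k)); rewrite lte_fin expr2 => /ltW.
case hpE : (h p) hp (hN p) => [r| |] // hp _; exists p, r; split=> // z s /muP.
by apply: le_trans; move: hp; rewrite lee_fin lerBrDr.
Qed.

(** Moreau decomposition: first-order optimality of the proximal point [p] makes [c - p] a
    subgradient of [h] at [p]. *)
Lemma prox_decomposition h c : closed_proper_convex ip h ->
  exists p q (r : R), [/\ p + q = c, h p = r%:E &
    (fenchel_conjugate ip h q <= ('[q, p] - r)%:E)%E].
Proof.
move=> hcpc; have [p [r [hp pP]]] := prox_exists c hcpc.
exists p, (c - p), r; split=> //; first by rewrite addrC subrK.
apply/fenchel_conjugate_leP => y; case hy : (h y) => [s| |]; rewrite ?leey //; last first.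
  by case: hcpc => /(_ y); rewrite hy.
rewrite lee_fin -subr_ge0.
suff : 0 <= s - r - '[c - p, y - p] by rewrite ipVDr ipVNr; lra.
(* Compare [p] with the point a fraction [t] of the way to [y]; after division by [t] the quadratic
   remainder is of order [t]. *)
apply: (@ge0_of_affine_ge0 _ _ (2^-1 * '[y - p, y - p])) => t t01.
have := pP (t *: y + (1 - t) *: p) (t * s + (1 - t) * r).
rewrite (@convex_le _ _ _ _ h t s r y p hcpc t01) ?hy ?hp // => /(_ isT).
have -> : t *: y + (1 - t) *: p - c = t *: (y - p) - (c - p).
  rewrite scalerBr scalerBl scale1r opprB [RHS]addrA; congr (_ - c).
  by rewrite -[RHS]addrA; congr (_ + _); rewrite addrC.
rewrite (normV_distC _ p c) (normV_sqrB _ (t *: _)) normVZ exprMn real_normK ?num_real //.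
rewrite ipVZl !normV_sqr (ipVC _ (c - p)) => H.
case/andP: t01 => t0 _.
by rewrite -(pmulr_rge0 _ t0); move: H; lra.
Qed.

(* With [p + q = x + z] and [q] a subgradient of [h] at [p], adding the two
   subgradient inequalities gives [|x - p|^2 <= 0]. *)
Lemma fenchel_equality h x z (s : R) : closed_proper_convex ip h ->
  fenchel_conjugate ip h z = s%:E ->
  (forall u (b : R), (fenchel_conjugate ip h u <= b%:E)%E ->
     s + '[x, u - z] <= b) ->
  h x = ('[x, z] - s)%:E.
Proof.
move=> hcpc hz sub; have [p [q [r [pq hp hq]]]] := prox_decomposition (x + z) hcpc.
have h1 := sub _ _ hq.
have h2 : '[z, p] - r <= s.
  by have := ipV_sub_le_fenchel_conjugate ip h z p; rewrite hp hz lee_fin.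
have qz : q - z = x - p.
  by rewrite -(addKr p q) pq addrA addrK addrC.
have px : p = x.
  apply/eqP; rewrite eq_sym -subr_eq0; apply/eqP/(ipVxx_eq0 (ip := ip))/eqP.
  rewrite eq_le ipVxx_ge0 andbT -{2}qz ipVDl ipVNl (ipVC _ p) (ipVDl _ q) ipVNl.
  by move: h1 h2; lra.
have qzE : q = z by apply/eqP; rewrite -subr_eq0 qz px subrr.
rewrite -px hp; congr (_%:E); move: h1 h2; rewrite qzE -px subrr ipV0r (ipVC ip z).
by lra.
Qed.

Lemma fenchel_conjugate_proper h : closed_proper_convex ip h ->
  exists z, (fenchel_conjugate ip h z < +oo)%E.
Proof.
move=> /(prox_decomposition 0)[p [q [r [_ _ hq]]]].
by exists q; apply: le_lt_trans hq _; rewrite ltry.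
Qed.

Lemma fenchel_conjugate_convex h z u (t a b : R) : 0 <= t <= 1 ->
  (fenchel_conjugate ip h u <= a%:E)%E ->
  (fenchel_conjugate ip h z <= b%:E)%E ->
  (fenchel_conjugate ip h (z + t *: (u - z))%R <= (b + t * (a - b))%:E)%E.
Proof.
move=> /andP[t0 t1] /fenchel_conjugate_leP ha /fenchel_conjugate_leP hb.
apply/fenchel_conjugate_leP => x; have := ha x; have := hb x.
case: (h x) => [r| |]; rewrite ?leey // !lee_fin.
by rewrite ipVDl ipVZl ipVDl ipVNl; nra.
Qed.

End Subgradient.

(** * The block minimization step *)

Section Summands.
Context (R : realType) (X : finDimNormedType R) (ip : {dot X for idfun}).
Context (ip_norm : induces_norm ip) (V : finType) (E : {set {set V}}).
Local Notation XV := {ffun V -> X}.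
Local Notation "'[ x , y ]" := (ipV ip x y).

(** Through [ip_norm], this carries convergence in [normV] over to each component in the norm of
    [X]. *)
Lemma normr_le_normV (x : XV) i : `|x i| <= normV ip x.
Proof.
rewrite -ler_sqr ?nnegrE ?normV_ge0 // normV_sqr ip_norm.
rewrite /ipV (bigD1 i) //= lerDl; apply: sumr_ge0 => j _.
by rewrite -ip_norm sqr_ge0.
Qed.

Lemma edge_space0 (e : edge E) : edge_space e (0 : XV).
Proof. by move=> i j _ _; rewrite !ffunE. Qed.

Lemma edge_spaceZ (e : edge E) (t : R) (x : XV) :
  edge_space e x -> edge_space e (t *: x).
Proof. by move=> ex i j ie je; rewrite !ffunE (ex i j). Qed.

Lemma edge_spaceD (e : edge E) (x y : XV) :
  edge_space e x -> edge_space e y -> edge_space e (x + y).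
Proof. by move=> ex ey i j ie je; rewrite !ffunE (ex i j) // (ey i j). Qed.

Lemma indicator_in (A : set XV) (x : XV) : A x -> indicator A x = 0%E :> \bar R.
Proof. by move=> Ax; rewrite /indicator mem_set. Qed.

Lemma indicator_out (A : set XV) (x : XV) :
  ~ A x -> indicator A x = +oo%E :> \bar R.
Proof. by move=> Ax; rewrite /indicator memNset. Qed.

Lemma edge_indicator_cpc (e : edge E) :
  closed_proper_convex ip (indicator (edge_space e)).
Proof.
split.
- by move=> x; rewrite /indicator; case: ifP.
- by exists 0; rewrite indicator_in ?ltry //; exact: edge_space0.
- move=> u l c ul; have [le|] := pselect (edge_space e l).
    rewrite indicator_in // => c0; apply: nearW => n.
    have [un|un] := pselect (edge_space e (u n)); first by rewrite indicator_in.
    by rewrite indicator_out // ltry.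
  move=> /existsNP[i /existsNP[j /not_implyP[ie /not_implyP[je lij]]]] _.
  (* A point within half the gap between [l i] and [l j] cannot have equal components at [i] and
     [j]. *)
  have lij0 : 0 < `|l i - l j| / 2.
    by rewrite divr_gt0 // normr_gt0 subr_eq0; apply/eqP.
  apply: filterS (norm_cvg_near ul lij0) => n un.
  rewrite indicator_out ?ltry // => /(_ i j ie je) uij.
  have := normr_le_normV (u n - l) i; have := normr_le_normV (u n - l) j.
  rewrite !ffunE uij => uj ui.
  have := ler_distD (u n j) (l i) (l j).
  by rewrite (distrC (l i) (u n j)); move: lij0 un ui uj; lra.
- move=> t x y /andP[t0 t1].
  have t10 : 0 < 1 - t by rewrite subr_gt0.
  have [ex|ex] := pselect (edge_space e x); last first.
    rewrite (indicator_out ex) gt0_muley ?lte_fin // addye ?leey //.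
    rewrite /indicator; case: ifP => _; first by rewrite mule0.
    by rewrite gt0_muley ?lte_fin.
  have [ey|ey] := pselect (edge_space e y); last first.
    rewrite (indicator_out ey) gt0_muley ?lte_fin // addey ?leey //.
    by rewrite indicator_in // mule0.
  rewrite !indicator_in ?mule0 ?adde0 //.
  by apply: edge_spaceD; exact: edge_spaceZ.
Qed.

Lemma conjugate_indicator_perp (e : edge E) (z : XV) :
  perp ip (edge_space e) z ->
  fenchel_conjugate ip (indicator (edge_space e)) z = 0%E.
Proof.
move=> pz; apply/eqP; rewrite eq_le; apply/andP; split.
  apply/fenchel_conjugate_leP => x; rewrite subr0.
  have [ex|ex] := pselect (edge_space e x).
    by rewrite indicator_in // ipVC pz.
  by rewrite indicator_out ?leey.
apply: le_trans (ipV_sub_le_fenchel_conjugate _ _ _ 0).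
by rewrite indicator_in ?ipV0r ?sube0 //; exact: edge_space0.
Qed.

Lemma conjugate_indicator_fin_perp (e : edge E) (z : XV) :
  (fenchel_conjugate ip (indicator (edge_space e)) z < +oo)%E ->
  perp ip (edge_space e) z.
Proof.
move=> zfin x ex.
have [s /fenchel_conjugate_leP zs] : exists s : R,
    (fenchel_conjugate ip (indicator (edge_space e)) z <= s%:E)%E.
  by case: (fenchel_conjugate _ _ _) zfin => [s| |] // _;
    [exists s | exists 0; rewrite leNye].
apply/eqP; apply: contrapT => /negP xz0.
(* This multiple of [x] has pairing [s + 1] with [z], above the bound [s]. *)
have := zs (((s + 1) / '[x, z]) *: x).
rewrite indicator_in; last exact: edge_spaceZ.
rewrite ipVZr (ipVC _ z) divfK // lee_fin; lra.
Qed.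

Lemma vertex_cpc (g : X -> \bar R) (i : V) : closed_convex g ->
  (exists x, (g x < +oo)%E) ->
  closed_proper_convex ip (fun x : XV => g (x i)).
Proof.
move=> [gN glsc gcvx] [xh xhP].
split; first by move=> x; exact: gN.
- by exists [ffun=> xh]; rewrite ffunE.
- move=> u l c ul /glsc[A /nbhs_normP[/= e e0 eA] cA].
  apply: filterS (norm_cvg_near ul e0) => n un; apply: cA; apply: eA => /=.
  rewrite /ball_ distrC; apply: le_lt_trans un.
  by have := normr_le_normV (u n - l) i; rewrite !ffunE.
- by move=> t x y t01; rewrite !ffunE; exact: gcvx.
Qed.

Lemma summand_cpc (f : V -> X -> \bar R) : (forall i, closed_convex (f i)) ->
  (exists xhat, forall i, (f i xhat < +oo)%E) ->
  forall a : dual_index E, closed_proper_convex ip (summand f a).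
Proof.
move=> fcc [xhat xhatP] [e|i]; first exact: edge_indicator_cpc.
by apply: vertex_cpc => //; exists xhat.
Qed.

End Summands.

(** * Optimality conditions of the block problem *)

Section Block.
Context (R : realType) (X : finDimNormedType R) (ip : {dot X for idfun}).
Context (V : finType) (E : {set {set V}}).
Local Notation XV := {ffun V -> X}.
Local Notation "'[ x , y ]" := (ipV ip x y).
Context (f : V -> X -> \bar R).
Hypothesis f_cpc : forall a : dual_index E, closed_proper_convex ip (summand f a).
Context (x0 : XV) (S : {set dual_index E}) (zold y : dual_index E -> XV).
Hypothesis y_min : is_minimizer (block_objective ip f x0 S zold) y.
Local Notation conj a := (fenchel_conjugate ip (summand f a)).

Lemma block_objective_fin (c : dual_index E -> R) (w : dual_index E -> XV) :
  (forall a, a \in S -> (conj a (w a) <= (c a)%:E)%E) ->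
  (block_objective ip f x0 S zold w <=
   (2^-1 * normV ip (x0 - \sum_(a | a \notin S) zold a - \sum_(a in S) w a)%R ^+ 2
     + \sum_(a in S) c a)%:E)%E.
Proof.
by move=> wc; rewrite EFinD leeD2l // -sumEFin; apply: lee_sum.
Qed.

(** Every conjugate is proper, so some competitor has an objective below +oo, whereas an infinite
    term at [a] would make the minimum +oo, no other term being -oo. *)
Lemma block_min_lt_pinfty a : a \in S -> (conj a (y a) < +oo)%E.
Proof.
move=> aS; rewrite ltey; apply/eqP => ya.
have /choice[w wP] : forall b : dual_index E, exists w, exists c : R,
    (conj b w <= c%:E)%E.
  move=> b; have [w] := fenchel_conjugate_proper (f_cpc b).
  case we : (conj b w) => [c| |] // _; exists w; first by exists c; rewrite we.
  by exists 0; rewrite we leNye.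
have /choice[c cP] := wP.
have := le_trans (y_min w) (block_objective_fin (fun b _ => cP b)).
rewrite /block_objective [X in (_ + X)%E](bigD1 a) //= ya addye ?addey ?leye_eq //.
rewrite esum_eqNy; apply/existsPn => b; rewrite negb_and.
by rewrite fenchel_conjugate_gt_ninfty ?orbT.
Qed.

(** The residual is a subgradient of the conjugate at [y b]: only component [b] is perturbed,
    towards [u], and the step [t] tends to 0. *)
Lemma block_min_subgradient b u (beta : R) : b \in S ->
  (conj b u <= beta%:E)%E ->
  fine (conj b (y b)) +
    '[x0 - \sum_(a | a \notin S) zold a - \sum_(a in S) y a, u - y b] <= beta.
Proof.
move=> bS ub; set x := _ - _ - _.
have yfin a : a \in S -> conj a (y a) = (fine (conj a (y a)))%:E.
  move=> aS; rewrite fineK // fin_numE fenchel_conjugate_gt_ninfty //=.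
  by rewrite -ltey block_min_lt_pinfty.
rewrite -lerBrDl -subr_ge0; set s := fine (conj b _).
apply: (@ge0_of_affine_ge0 _ _ (2^-1 * normV ip (u - y b) ^+ 2)) => t /andP[t0 t1].
pose w a := if a == b then y b + t *: (u - y b) else y a.
pose c a := if a == b then s + t * (beta - s) else fine (conj a (y a)).
have wc a : a \in S -> (conj a (w a) <= (c a)%:E)%E.
  move=> aS; rewrite /w /c; case: eqP => [->|_]; last by rewrite -yfin.
  by apply: fenchel_conjugate_convex; rewrite ?(ltW t0) // -yfin.
have := le_trans (y_min w) (block_objective_fin wc).
rewrite /block_objective (eq_bigr _ yfin) sumEFin -EFinD lee_fin.
have -> : \sum_(a in S) w a = t *: (u - y b) + \sum_(a in S) y a.
  rewrite !(bigD1 (P := fun a => a \in S) b) //= {1}/w eqxx addrCA addrA.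
  congr (_ + _); apply: eq_bigr => a /andP[_ /negPf ab].
  by rewrite /w ab.
have -> : \sum_(a in S) c a = t * (beta - s) + \sum_(a in S) fine (conj a (y a)).
  rewrite !(bigD1 (P := fun a => a \in S) b) //= {1}/c eqxx addrCA addrA.
  congr (_ + _); apply: eq_bigr => a /andP[_ /negPf ab].
  by rewrite /c ab.
rewrite -/x.
have -> : x0 - \sum_(a | a \notin S) zold a -
    (t *: (u - y b) + \sum_(a in S) y a) = x - t *: (u - y b).
  by rewrite opprD addrA addrAC.
rewrite (normV_sqrB _ x (t *: _)) normVZ exprMn real_normK ?num_real // ipVZr => H.
by rewrite -(pmulr_rge0 _ t0); move: H; lra.
Qed.

End Block.

(** * Ascent of the dual value along a run *)

Lemma in_bigcup_nat (T : finType) (F : nat -> {set T}) (m n : nat) (a : T) :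
  a \in (\bigcup_(m <= i < n) F i)%SET -> exists2 i, (m <= i < n)%N & a \in F i.
Proof.
rewrite big_seq; elim/big_ind: _ => [|A B IA IB|i].
- by rewrite inE.
- by rewrite inE => /orP[/IA|/IB].
- by rewrite mem_index_iota => mi ai; exists i.
Qed.

Section LastUpdate.
Context (V : finType) (E : {set {set V}}) (S : nat -> nat -> {set dual_index E}).
Context (wbar : nat) (wbar_gt0 : (0 < wbar)%N).

Lemma last_updateP n (a : dual_index E) :
  (exists2 w, (0 < w <= wbar)%N & a \in S n w) ->
  [/\ (0 < last_update S wbar n a <= wbar)%N,
      a \in S n (last_update S wbar n a) &
      forall w, (last_update S wbar n a < w <= wbar)%N -> a \notin S n w].
Proof.
move=> [[|w] //= ww aS].
have ex : [exists m : 'I_wbar, a \in S n m.+1].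
  by apply/existsP; exists (Ordinal ww).
rewrite /last_update ex.
pose A := [pred m : 'I_wbar | a \in S n m.+1].
have A0 : (0 < #|A|)%N by apply/card_gt0P; exists (Ordinal ww).
have [m mA mE] := eq_bigmax_cond (fun m : 'I_wbar => m.+1) A0.
split; rewrite ?mE //; first exact: ltn_ord.
move=> [|v] // /andP[+ vw]; rewrite ltnNge; apply: contra => aSv.
by rewrite -mE; exact: (@leq_bigmax_cond _ A (fun m => m.+1) (Ordinal vw)).
Qed.

Lemma last_update_bounds n (a : dual_index E) :
  (0 < last_update S wbar n a <= wbar)%N.
Proof.
case: (pselect (exists2 w, (0 < w <= wbar)%N & a \in S n w)) => [/last_updateP[]//|aS].
rewrite /last_update; case: ifP => [/existsP[m mS]|]; last by rewrite wbar_gt0 leqnn.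
by case: aS; exists m.+1 => //; exact: ltn_ord.
Qed.

End LastUpdate.

Section Run.
Context (R : realType) (X : finDimNormedType R) (ip : {dot X for idfun}).
Context (V : finType) (E : {set {set V}}).
Local Notation XV := {ffun V -> X}.
Local Notation "'[ x , y ]" := (ipV ip x y).
Context (f : V -> X -> \bar R).
Hypothesis f_cpc : forall a : dual_index E, closed_proper_convex ip (summand f a).
Context (x0 : XV) (C1 : R) (wbar : nat) (vH0 : nat -> XV).
Context (z : nat -> nat -> dual_index E -> XV).
Context (En : nat -> {set edge E}) (S : nat -> nat -> {set dual_index E}).
Hypothesis run : dykstra_run ip f x0 C1 wbar vH0 z En S.
Hypothesis V_covered : forall n, (0 < n)%N -> forall i : V,
  inr i \in (\bigcup_(1 <= w < wbar.+1) S n w)%SET.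
Local Notation conj a := (fenchel_conjugate ip (summand f a)).
Local Notation x_ n w := (iterate x0 z n w).
Local Notation v_ n w := (vA z n w).

Lemma vA_sum n w : v_ n w = \sum_(a : dual_index E) z n w a.
Proof. by rewrite big_sumType. Qed.

(** As [fine] sends infinities to 0, this is meaningful only where the conjugate is finite. *)
Definition conj_val n w a : R := fine (conj a (z n w a)).

Definition conj_fin n w : Prop := forall a, conj a (z n w a) = (conj_val n w a)%:E.

Lemma conj_finE a n w : (conj a (z n w a) < +oo)%E ->
  conj a (z n w a) = (conj_val n w a)%:E.
Proof.
by move=> lt; rewrite fineK // fin_numE fenchel_conjugate_gt_ninfty //= -ltey.
Qed.

(** Components outside the block are kept, so the residual of the block problem is the current
    iterate. *)
Lemma run_subgradient n w a u (beta : R) : (0 < n)%N -> (0 < w <= wbar)%N ->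
  a \in S n w -> (conj a u <= beta%:E)%E ->
  conj_val n w a + '[x_ n w, u - z n w a] <= beta.
Proof.
move=> n0 ww aS ub.
have := block_min_subgradient f_cpc (run_block_min run n0 ww) aS ub.
suff -> : x_ n w = x0 - \sum_(b | b \notin S n w) z n w.-1 b
  - \sum_(b in S n w) z n w b by [].
rewrite /iterate vA_sum (bigID (fun b => b \in S n w)) /= opprD addrA addrAC.
congr (_ - _ - _); apply: eq_bigr => b bS.
exact: run_block_keep run _ _ _ _ _ _.
Qed.

(** The restart gives orthogonality and a block update preserves it, because the conjugate of the
    indicator is finite only on the orthogonal complement. *)
Lemma edge_perp n w (e : edge E) : (0 < n)%N -> (w <= wbar)%N ->
  perp ip (edge_space e) (z n w (inl e)).
Proof.
move=> n0; elim: w => [_|w IH ww]; first exact: run_restart_perp run _ _ _.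
have [eS|eS] := boolP (inl e \in S n w.+1).
  apply: conjugate_indicator_fin_perp.
  exact: (block_min_lt_pinfty f_cpc (run_block_min run n0 (w := w.+1) ww) eS).
by rewrite (run_block_keep run n0 (w := w.+1) ww eS); apply: IH; apply: ltnW.
Qed.

Lemma edge_conj0 n w (e : edge E) : (0 < n)%N -> (w <= wbar)%N ->
  conj (inl e) (z n w (inl e)) = 0%E.
Proof. by move=> n0 ww; apply: conjugate_indicator_perp; exact: edge_perp. Qed.

Lemma active_last_update n a : (0 < n)%N ->
  (exists2 w, (0 < w <= wbar)%N & a \in S n w) ->
  z n wbar a = z n (last_update S wbar n a) a.
Proof.
move=> n0 aS; have [/andP[p0 pw] _ keep] := last_updateP aS.
suff H w : (last_update S wbar n a <= w <= wbar)%N ->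
    z n w a = z n (last_update S wbar n a) a by rewrite H // pw leqnn.
elim: w => [|w IH] /andP[]; first by rewrite leqNgt p0.
rewrite leq_eqVlt => /predU1P[<-//|pw1 ww].
rewrite (run_block_keep run n0 (w := w.+1)) ?keep ?pw1 //=.
by apply: IH; rewrite -ltnS pw1 ltnW.
Qed.

Lemma vertex_active n i : (0 < n)%N ->
  exists2 w, (0 < w <= wbar)%N & inr i \in S n w.
Proof. by move=> n0; exact: in_bigcup_nat (V_covered n0 i). Qed.

(** Each vertex is updated during the cycle, and its last update leaves a finite conjugate. The
    starting vertex components may have infinite conjugates, so finiteness can fail inside the first
    cycle. *)
Lemma conj_fin_wbar n : (0 < n)%N -> conj_fin n wbar.
Proof.
move=> n0 [e|i]; first by rewrite conj_finE // edge_conj0 // ltry.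
apply: conj_finE; have iS := vertex_active i n0; rewrite (active_last_update n0 iS).
have [pw pS _] := last_updateP iS.
exact: (block_min_lt_pinfty f_cpc (run_block_min run n0 pw) pS).
Qed.

Lemma conj_fin_next n w : (0 < n)%N -> (w <= wbar)%N -> conj_fin n.+1 w.
Proof.
move=> n0 ww [e|i]; first by rewrite conj_finE // edge_conj0 // ltry.
apply: conj_finE; elim: w ww => [_|w IH ww].
  by rewrite (run_next_z run i n0) conj_fin_wbar // ltry.
have [iS|iS] := boolP (inr i \in S n.+1 w.+1).
  exact: (block_min_lt_pinfty f_cpc (run_block_min run (ltn0Sn n) (w := w.+1) ww) iS).
by rewrite (run_block_keep run (ltn0Sn n) (w := w.+1) ww iS); apply: IH; apply: ltnW.
Qed.

Definition dual_val n w : R :=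
  - (2^-1 * normV ip (x_ n w) ^+ 2) + 2^-1 * normV ip x0 ^+ 2 - \sum_a conj_val n w a.

Lemma dualF_fin n w : conj_fin n w -> dualF ip f x0 (z n w) = (dual_val n w)%:E.
Proof.
move=> fin; rewrite /dualF /dual_val /iterate vA_sum.
by rewrite (eq_bigr _ (fun a _ => fin a)) sumEFin.
Qed.

(** Summing the subgradient inequalities at the previous components controls the conjugates;
    expanding the squared residuals then leaves half the squared move. *)
Lemma dual_val_step n w : (0 < n)%N -> (0 < w <= wbar)%N ->
  conj_fin n w.-1 -> conj_fin n w ->
  dual_val n w.-1 + 2^-1 * normV ip (v_ n w - v_ n w.-1) ^+ 2 <= dual_val n w.
Proof.
move=> n0 ww fin' fin.
have : \sum_a conj_val n w a + '[x_ n w, v_ n w.-1 - v_ n w] <= \sum_a conj_val n w.-1 a.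
  rewrite !vA_sum -sumrB ipV_sumr -big_split; apply: ler_sum => a _ /=.
  have [aS|aS] := boolP (a \in S n w).
    by apply: run_subgradient; rewrite ?fin'.
  by rewrite /conj_val (run_block_keep run n0 ww aS) subrr ipV0r addr0.
have -> : v_ n w.-1 - v_ n w = x_ n w - x_ n w.-1.
  by rewrite /iterate opprB [RHS]addrC addrA subrK.
have -> : v_ n w - v_ n w.-1 = x_ n w.-1 - x_ n w.
  by rewrite /iterate opprB [RHS]addrC addrA subrK.
rewrite /dual_val normV_sqrB ipVDr ipVNr -normV_sqr (ipVC _ (x_ n w.-1)); lra.
Qed.

(** Redistribution over the edges keeps their sum, and the edge conjugates are 0 before and
    after. *)
Lemma dual_val_restart n : (0 < n)%N -> dual_val n.+1 0 = dual_val n wbar.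
Proof.
move=> n0; have conjE a : conj_val n.+1 0 a = conj_val n wbar a.
  case: a => [e|i]; last by rewrite /conj_val (run_next_z run i n0).
  by rewrite /conj_val !edge_conj0.
have vE : v_ n.+1 0 = v_ n wbar.
  rewrite /vA; congr (_ + _); last by apply: eq_bigr => i _; exact: run_next_z run _ _ _.
  by rewrite /vH (run_restart_sum run) // (run_next_vH run n0).
by rewrite /dual_val /iterate vE (eq_bigr _ (fun a _ => conjE a)).
Qed.

(* The duality gap is [1/2 |x_ n w - y|^2] plus the Fenchel-Young defects. *)
Lemma duality_gap n w y (r : dual_index E -> R) : conj_fin n w ->
  (forall a, summand f a y = (r a)%:E) ->
  dual_val n w + 2^-1 * normV ip (x_ n w - y) ^+ 2 <=
    2^-1 * normV ip (y - x0) ^+ 2 + \sum_a r a.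
Proof.
move=> fin yr.
have : '[v_ n w, y] <= \sum_a conj_val n w a + \sum_a r a.
  rewrite vA_sum ipVC ipV_sumr -big_split; apply: ler_sum => a _ /=.
  have := ipV_sub_le_fenchel_conjugate ip (summand f a) (z n w a) y.
  by rewrite yr fin lee_fin ipVC lerBlDr.
have -> : v_ n w = x0 - x_ n w by rewrite /iterate subKr.
rewrite /dual_val !normV_sqrB ipVDl ipVNl (ipVC ip y x0); lra.
Qed.

(** Partial cycles are included because the bound on intermediate iterates needs them. *)
Lemma dual_val_mono_step n k : (0 < n)%N -> (k <= wbar)%N ->
  dual_val n wbar +
    2^-1 * \sum_(1 <= w < k.+1) normV ip (v_ n.+1 w - v_ n.+1 w.-1) ^+ 2
  <= dual_val n.+1 k.
Proof.
move=> n0; elim: k => [_|k IH kw].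
  by rewrite big_geq // mulr0 addr0 dual_val_restart.
rewrite big_nat_recr //= mulrDr addrA.
have := @dual_val_step n.+1 k.+1 (ltn0Sn n) kw
  (conj_fin_next n0 (ltnW kw)) (conj_fin_next n0 kw).
by apply: le_trans; rewrite lerD2r IH // ltnW.
Qed.

End Run.

(** * Bounded ascent sequences *)

Section SummableSequence.
Context (R : realType).

(* Otherwise [b n >= e / n] eventually and the harmonic series would converge. *)
Lemma small_times_index (b : nat -> R) (M : R) : (forall n, 0 <= b n) ->
  (forall N, \sum_(1 <= n < N) b n <= M) ->
  forall e N, 0 < e -> exists2 n, (N < n)%N & n%:R * b n < e.
Proof.
move=> b0 bM e N e0; apply: contrapT => noN.
have big n : (N < n)%N -> e <= n%:R * b n.
  by move=> Nn; rewrite leNgt; apply/negP => lt; apply: noN; exists n.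
apply: (@dvg_harmonic R); apply: nondecreasing_is_cvgn.
  apply/nondecreasing_seqP => n; rewrite /series /= big_nat_recr //= lerDl.
  by rewrite invr_ge0.
exists (e^-1 * M + N%:R) => _ [n _ <-].
have -> : series harmonic n = \sum_(0 <= k < n) k.+1%:R^-1 :> R by [].
(* The first [N] terms count at most 1 each; every later [k.+1%:R^-1] is at most [e^-1 * b k.+1]. *)
apply: (@le_trans _ _ (e^-1 * \sum_(1 <= k < n.+1) b k + (minn n N)%:R)).
  elim: n => [|n IH]; first by rewrite !big_geq // mulr0 min0n addr0.
  rewrite big_nat_recr //= [in leRHS]big_nat_recr //= mulrDr.
  have [nN|Nn] := ltnP n N.
    have : n.+1%:R^-1 <= 1 :> R by rewrite invf_le1 // ler1n.
    rewrite (minn_idPl nN); move: IH; rewrite (minn_idPl (ltnW nN)).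
    set h : R := n.+1%:R^-1; rewrite -natr1.
    have : 0 <= e^-1 * b n.+1 by rewrite mulr_ge0 // invr_ge0 ltW.
    lra.
  rewrite (minn_idPr (leqW Nn)); move: IH; rewrite (minn_idPr Nn).
  set h : R := n.+1%:R^-1; suff : h <= e^-1 * b n.+1 by lra.
  by rewrite ler_pdivlMl // ler_pdivrMr ?ltr0n // mulrC big.
apply: lerD; first by rewrite ler_wpM2l // invr_ge0 ltW.
by rewrite ler_nat geq_minr.
Qed.

(** The threshold is squared because its square root will bound the drift. The choice function also
    receives the previous index, which makes the recursion strictly increasing. *)
Lemma small_times_index_subseq (b : nat -> R) (M : R) : (forall n, 0 <= b n) ->
  (forall N, \sum_(1 <= n < N) b n <= M) ->
  exists nk : nat -> nat, [/\ forall k, (0 < nk k)%N,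
    {homo nk : k l / (k < l)%N} &
    forall k, (nk k)%:R * b (nk k) < k.+1%:R^-1 ^+ 2].
Proof.
move=> b0 bM.
have /choice[g gP] : forall p : nat * nat, exists n : nat,
    (p.1 < n)%N /\ n%:R * b n < p.2.+1%:R^-1 ^+ 2.
  move=> [N k] /=; have k0 : 0 < k.+1%:R^-1 ^+ 2 :> R.
    by rewrite exprn_gt0 // invr_gt0.
  by have [n] := small_times_index b0 bM N k0; exists n.
pose nk := fix nk k := if k is k'.+1 then g (nk k', k) else g (0%N, 0%N).
have nkP k : exists N, nk k = g (N, k) by case: k => [|k]; [exists 0%N|exists (nk k)].
exists nk; split=> [k||k].
- by have [N ->] := nkP k; apply: leq_ltn_trans (gP (N, k)).1.
- by apply: homo_ltn => [|k]; [exact: ltn_trans|exact: (gP (nk k, k.+1)).1].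
- by have [N ->] := nkP k; exact: (gP (N, k)).2.
Qed.

Context (D b : nat -> R) (P : R).
Hypotheses (b_ge0 : forall n, 0 <= b n) (DP : forall n, (0 < n)%N -> D n <= P).
Hypothesis D_step : forall n, (0 < n)%N -> D n + 2^-1 * b n.+1 <= D n.+1.

(** Telescoping of [D_step], which controls only [b n] with [n >= 2]; hence the separate term
    [b 1]. *)
Lemma ascent_sum_bound N : \sum_(1 <= n < N) b n <= b 1 + 2 * (P - D 1).
Proof.
case: N => [|[|N]]; try by rewrite big_geq // addr_ge0 // mulr_ge0 // subr_ge0 DP.
apply: (@le_trans _ _ (b 1 + 2 * (D N.+1 - D 1))); last first.
  by have := DP (ltn0Sn N); lra.
elim: N => [|N IH]; first by rewrite big_nat1 subrr mulr0 addr0.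
rewrite big_nat_recr //=.
by move: IH (D_step (ltn0Sn N)); lra.
Qed.

Lemma ascent_homo m n : (0 < m)%N -> (m <= n)%N -> D m <= D n.
Proof.
move=> m0; elim: n => [|n IH]; first by rewrite leqNgt m0.
rewrite leq_eqVlt => /predU1P[-> //|]; rewrite ltnS => mn.
apply: le_trans (IH mn) _; apply: le_trans (D_step (leq_trans m0 mn)).
by rewrite lerDl mulr_ge0 // invr_ge0.
Qed.

Lemma ascent_cvg : exists L : R, D @ \oo --> L.
Proof.
have nd : nondecreasing_seq (fun n => D n.+1).
  by move=> m n mn; apply: ascent_homo.
have ub : has_ubound (range (fun n => D n.+1)).
  by exists P => _ [n _ <-]; apply: DP.
have c := nondecreasing_is_cvgn nd ub.
by exists (limn (fun n => D n.+1)); rewrite -(cvg_shiftS D).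
Qed.

(** For positive [n], [b n.+1] is squeezed between 0 and twice an increment of the convergent
    sequence [D]. *)
Lemma ascent_increment_cvg0 : b @ \oo --> 0.
Proof.
have [L DL] := ascent_cvg; rewrite -(cvg_shiftS b).
have : (fun n => 2 * (D n.+1 - D n)) @ \oo --> 2 * (L - L).
  by apply: cvgMl_tmp; apply: cvgB => //; rewrite (cvg_shiftS D).
rewrite subrr mulr0; apply: (squeeze_cvgr _ (cvg_cst 0)).
exists 1%N => // n /= n0; rewrite b_ge0 /=.
by have := D_step n0; lra.
Qed.

End SummableSequence.

(** Turns termwise lower bounds, as semicontinuity provides them, into finiteness of every term and
    a bound on the total. *)
Lemma sum_lt_bound (R : realType) (I : finType) (g : I -> \bar R) (K : R) :
  (forall a, g a != -oo%E) ->
  (forall c : I -> R, (forall a, ((c a)%:E < g a)%E) -> \sum_a c a <= K) ->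
  exists2 r : I -> R, forall a, g a = (r a)%:E & \sum_a r a <= K.
Proof.
move=> gN gK.
have /choice[c0 c0P] : forall a, exists c : R, (c%:E < g a)%E.
  move=> a; case: (g a) (gN a) => [r| |] // _.
    by exists (r - 1); rewrite lte_fin gtrBl.
  by exists 0; rewrite ltry.
have gfin a : g a = (fine (g a))%:E.
  rewrite fineK // fin_numE gN /=; apply/eqP => ga.
  (* An infinite term leaves room for a choice whose total is [K + 1]. *)
  pose c b := if b == a then K - \sum_(d | d != a) c0 d + 1 else c0 b.
  have /gK : forall b, ((c b)%:E < g b)%E.
    by move=> b; rewrite /c; case: eqP => [->|//]; rewrite ga ltry.
  rewrite (bigD1 a) //= {1}/c eqxx (eq_bigr c0); last first.
    by move=> b /negPf ba; rewrite /c ba.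
  lra.
exists (fun a => fine (g a)) => //; apply/ler_addgt0Pr => e e0.
have cN : 0 < #|I|%:R + 1 :> R by rewrite ltr_wpDl.
(* Lowering every term by [d] costs at most [e] in total; the added 1 covers an empty [I]. *)
pose d := e / (#|I|%:R + 1).
have d0 : 0 < d by rewrite divr_gt0.
have /gK : forall a, ((fine (g a) - d)%:E < g a)%E.
  by move=> a; rewrite [ltRHS]gfin lte_fin gtrBl.
rewrite sumrB sumr_const -mulr_natl.
suff : #|I|%:R * d <= e by lra.
have -> : e = d * (#|I|%:R + 1) by rewrite divfK // gt_eqF.
by rewrite mulrC ler_pM2l // lerDl.
Qed.

(** * Convergence of the run *)

Section Convergence.
Context (R : realType) (X : finDimNormedType R) (ip : {dot X for idfun}).
Context (V : finType) (E : {set {set V}}).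
Local Notation XV := {ffun V -> X}.
Local Notation "'[ x , y ]" := (ipV ip x y).
Context (f : V -> X -> \bar R).
Hypothesis f_cpc : forall a : dual_index E, closed_proper_convex ip (summand f a).
Hypothesis feasible : exists xhat : X, forall i, (f i xhat < +oo)%E.
Context (x0 : XV) (C1 : R) (wbar : nat) (vH0 : nat -> XV).
Context (z : nat -> nat -> dual_index E -> XV).
Context (En : nat -> {set edge E}) (S : nat -> nat -> {set dual_index E}).
Hypothesis run : dykstra_run ip f x0 C1 wbar vH0 z En S.
Hypothesis En_covered : forall n, (0 < n)%N -> forall e : edge E,
  (e \in En n) = (inl e \in (\bigcup_(1 <= w < wbar.+1) S n w)%SET).
Hypothesis V_covered : forall n, (0 < n)%N -> forall i : V,
  inr i \in (\bigcup_(1 <= w < wbar.+1) S n w)%SET.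
Context (A B : R).
Hypothesis growth : forall n, (0 < n)%N ->
  \sum_(a : dual_index E) normV ip (z n wbar a) <= A * Num.sqrt n%:R + B.
Local Notation x_ n w := (iterate x0 z n w).
Local Notation v_ n w := (vA z n w).
Local Notation p_ n a := (last_update S wbar n a).
Local Notation D n := (dual_val ip f x0 z n wbar).

Definition cycle_move n : R :=
  \sum_(1 <= w < wbar.+1) normV ip (v_ n w - v_ n w.-1) ^+ 2.

Lemma cycle_move_ge0 n : 0 <= cycle_move n.
Proof. by apply: sumr_ge0 => w _; exact: sqr_ge0. Qed.

Lemma step_le_cycle_move n w : (0 < w <= wbar)%N ->
  normV ip (v_ n w - v_ n w.-1) <= Num.sqrt (cycle_move n).
Proof.
move=> ww; rewrite -(ger0_norm (normV_ge0 ip _)) -sqrtr_sqr ler_wsqrtr //.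
rewrite /cycle_move (bigD1_seq w) ?mem_index_iota ?iota_uniq //= lerDl.
by apply: sumr_ge0 => k _; exact: sqr_ge0.
Qed.

Lemma drift_le_cycle_move n m : (m <= wbar)%N ->
  normV ip (v_ n wbar - v_ n m) <= wbar%:R * Num.sqrt (cycle_move n).
Proof.
move=> mw.
suff H k : (m <= k <= wbar)%N ->
    normV ip (v_ n k - v_ n m) <= k%:R * Num.sqrt (cycle_move n).
  by apply: H; rewrite mw leqnn.
elim: k => [|k IH] /andP[].
  by rewrite leqn0 => /eqP -> _; rewrite subrr normV0 mul0r.
rewrite leq_eqVlt => /predU1P[-> _|mk kw].
  by rewrite subrr normV0 mulr_ge0 ?sqrtr_ge0.
apply: le_trans (ler_normVB _ _ (v_ n k) _) _.
rewrite -natr1 mulrDl mul1r addrC lerD //.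
  by apply: IH; rewrite -ltnS mk ltnW.
exact: (@step_le_cycle_move n k.+1 kw).
Qed.

Lemma dual_step n : (0 < n)%N -> D n + 2^-1 * cycle_move n.+1 <= D n.+1.
Proof. by move=> n0; exact: (dual_val_mono_step f_cpc run V_covered n0 (leqnn _)). Qed.

(** The constant point [xhat] satisfies all edge constraints, so every summand is finite there and
    the duality gap bounds dual values and iterates by one constant. *)
Lemma feasible_point : exists (y : XV) (P : R), forall n w, conj_fin ip f z n w ->
  dual_val ip f x0 z n w + 2^-1 * normV ip (x_ n w - y) ^+ 2 <= P.
Proof.
have [xhat xhatP] := feasible; pose y : XV := [ffun=> xhat].
have yfin (a : dual_index E) : summand f a y = (fine (summand f a y))%:E :> \bar R.
  rewrite fineK // fin_numE; case: (f_cpc a) => -> _ _ _ /=; rewrite -ltey.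
  case: a => [e|i] /=; last by rewrite ffunE.
  by rewrite indicator_in ?ltry // => i j _ _; rewrite !ffunE.
exists y; eexists => n w fin; exact: duality_gap fin yfin.
Qed.

Lemma dual_bound : exists P, forall n, (0 < n)%N -> D n <= P.
Proof.
have [y [P yP]] := feasible_point; exists P => n n0.
apply: le_trans (yP n wbar (conj_fin_wbar f_cpc run V_covered n0)).
by rewrite lerDl mulr_ge0 ?invr_ge0 ?sqr_ge0.
Qed.

Lemma cycle_move_summable : exists M, forall N, \sum_(1 <= n < N) cycle_move n <= M.
Proof.
have [P DP] := dual_bound; eexists => N.
exact: (ascent_sum_bound cycle_move_ge0 DP dual_step).
Qed.

Lemma cycle_move_series_lt_pinfty :
  (\sum_(1 <= n <oo) (cycle_move n)%:E < +oo)%E.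
Proof.
have [M MP] := cycle_move_summable; apply: le_lt_trans (ltry M).
apply: lime_le.
  by apply: is_cvg_nneseries => n _ _; rewrite lee_fin cycle_move_ge0.
by apply: nearW => N; rewrite sumEFin lee_fin.
Qed.

Lemma dualF_nondecreasing m n : (0 < m)%N -> (m <= n)%N ->
  (dualF ip f x0 (z m wbar) <= dualF ip f x0 (z n wbar))%E.
Proof.
move=> m0 mn; have n0 := leq_trans m0 mn.
rewrite !dualF_fin; try exact: (conj_fin_wbar f_cpc run V_covered).
rewrite lee_fin.
exact: (ascent_homo (D := fun n => D n) cycle_move_ge0 dual_step m0 mn).
Qed.

Lemma vA_bounded : exists C : R, forall n w, (0 < n)%N -> (w <= wbar)%N ->
  normV ip (v_ n w) ^+ 2 <= C.
Proof.
have [y [P yP]] := feasible_point.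
pose c1 := \sum_(w < wbar.+1) normV ip (v_ 1 w) ^+ 2.
(* The squared norm of [v_ n w] is at most [2 |x0 - y|^2 + 2 |x - y|^2] with [x] the iterate, and
   [|x - y|^2 <= 2 (P - D 1)] by weak duality and ascent. *)
pose c2 := 2 * normV ip (x0 - y) ^+ 2 + 4 * (P - D 1).
have c10 : 0 <= c1 by apply: sumr_ge0 => w _; exact: sqr_ge0.
have c20 : 0 <= c2.
  apply: addr_ge0; apply: mulr_ge0; rewrite ?sqr_ge0 // subr_ge0.
  apply: le_trans (yP 1%N wbar (conj_fin_wbar f_cpc run V_covered (ltn0Sn 0))).
  by rewrite lerDl mulr_ge0 ?invr_ge0 ?sqr_ge0.
(* The first cycle, where conjugates may be infinite, has finitely many iterates and is bounded by
   [c1] directly. *)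
exists (c1 + c2) => -[|[|n]] // w _ ww.
  apply: (@le_trans _ _ c1); last by rewrite lerDl.
  rewrite /c1 (bigD1 (Ordinal (ww : (w < wbar.+1)%N))) //= lerDl.
  by apply: sumr_ge0 => k _; exact: sqr_ge0.
apply: (@le_trans _ _ c2); last by rewrite lerDr.
have := yP n.+2 w (conj_fin_next f_cpc run V_covered (ltn0Sn n) ww).
have := dual_val_mono_step f_cpc run V_covered (ltn0Sn n) ww.
have := ascent_homo (D := fun n => D n) cycle_move_ge0 dual_step (ltn0Sn 0) (ltn0Sn n).
have : 0 <= \sum_(1 <= k < w.+1) normV ip (v_ n.+2 k - v_ n.+2 k.-1) ^+ 2.
  by apply: sumr_ge0 => k _; exact: sqr_ge0.
have -> : v_ n.+2 w = (x0 - y) - (x_ n.+2 w - y).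
  by rewrite /iterate opprB addrA subrK subKr.
have := ipVxx_ge0 ip ((x0 - y) + (x_ n.+2 w - y)).
by rewrite -normV_sqr normV_sqrD (normV_sqrB _ (x0 - y) (_ - y)) /c2; lra.
Qed.

(** Along [nk] the drift times the square root of [nk k] is at most [wbar] times [k.+1%:R^-1], which
    absorbs the growth of the components; boundedness then yields a convergent refinement. *)
Lemma good_subsequence_exists :
  exists (nk : nat -> nat) (vstar : XV), good_subsequence ip S wbar z nk vstar.
Proof.
have [M MP] := cycle_move_summable.
have [nk [nk0 nki nkb]] := small_times_index_subseq cycle_move_ge0 MP.
have [C CP] := vA_bounded.
have vb k : normV ip (v_ (nk k) wbar) <= Num.sqrt C.
  by rewrite -(ger0_norm (normV_ge0 ip _)) -sqrtr_sqr ler_wsqrtr // CP.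
have [g [vstar [gi gv]]] := bolzano_weierstrass_ffun vb.
exists (nk \o g), vstar; split => //.
- by move=> k; exact: nk0.
- by move=> k l kl; exact/nki/gi.
move=> a.
(* The pairing tends to 0 along all of [nk], hence along its refinement by [g]. *)
suff H : (fun k => '[v_ (nk k) wbar - v_ (nk k) (p_ (nk k) a), z (nk k) wbar a])
    @ \oo --> (0 : R).
  move=> U /H; pose u k := '[v_ (nk k) wbar - v_ (nk k) (p_ (nk k) a),
    z (nk k) wbar a].
  exact: (near_subseq (P := fun k => U (u k))).
apply/norm_cvg0P.
have K0 : (fun k => wbar%:R * (`|A| + `|B|) * (harmonic k : R)) @ \oo --> (0 : R).
  by rewrite -(mulr0 (wbar%:R * (`|A| + `|B|))); apply: cvgMl_tmp; exact: cvg_harmonic.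
apply: (squeeze_cvgr _ (cvg_cst 0) K0); apply: nearW => k; rewrite normr_ge0 /=.
apply: le_trans (normr_ipV_le _ _ _) _.
have /andP[_ pw] := last_update_bounds S (run_wbar run) (nk k) a.
have n0 := nk0 k; have := nkb k; move: (nk k) n0 pw => n n0 pw nb.
(* Since [n] is positive, its square root is at least 1 and absorbs the constant [B]. *)
have sn1 : 1 <= Num.sqrt n%:R :> R by rewrite -[leLHS]sqrtr1 ler_wsqrtr // ler1n.
have za : normV ip (z n wbar a) <= (`|A| + `|B|) * Num.sqrt n%:R.
  apply: (@le_trans _ _ (\sum_a normV ip (z n wbar a))).
    by rewrite (bigD1 a) //= lerDl sumr_ge0 // => b _; exact: normV_ge0.
  apply: le_trans (growth n0) _; rewrite mulrDl lerD //.
    by rewrite ler_wpM2r ?sqrtr_ge0 ?ler_norm.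
  by apply: le_trans (ler_norm _) _; rewrite ler_peMr.
apply: le_trans (ler_pM (normV_ge0 _ _) (normV_ge0 _ _) (drift_le_cycle_move n pw) za) _.
rewrite mulrACA ler_wpM2l ?mulr_ge0 ?addr_ge0 //.
rewrite mulrC -sqrtrM // -(ger0_norm (_ : 0 <= k.+1%:R^-1)) ?invr_ge0 //.
by rewrite -sqrtr_sqr ler_wsqrtr // ltW.
Qed.

(** * Identification of the limit of a good subsequence *)

Section Limit.
Context (nk : nat -> nat) (vstar : XV).
Hypothesis good : good_subsequence ip S wbar z nk vstar.
Local Notation xstar := (x0 - vstar).

Let nk_gt0 k : (0 < nk k)%N. Proof. by case: good. Qed.
Let nk_homo : {homo nk : k l / (k < l)%N}.
Proof. by case: good => _ H _ _ k l; exact: H. Qed.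

(* For an active [a] this is [h_a] at the iterate of its last update, for an
   inactive edge it is 0. *)
Let primal_val n a : R :=
  '[x_ n (p_ n a), z n wbar a] - conj_val ip f z n wbar a.

Let conj_fin_last n : (0 < n)%N -> conj_fin ip f z n wbar.
Proof. exact: (conj_fin_wbar f_cpc run V_covered). Qed.

(** At the last update of [a] the iterate is a subgradient of the conjugate at a component that
    stays fixed until the end of the cycle, so [fenchel_equality] applies. *)
Lemma active_primal_val n a : (0 < n)%N ->
  (exists2 w, (0 < w <= wbar)%N & a \in S n w) ->
  summand f a (x_ n (p_ n a)) = (primal_val n a)%:E.
Proof.
move=> n0 aS; have [pw pS _] := last_updateP aS.
apply: (fenchel_equality (f_cpc a)); first exact: conj_fin_last.
move=> u beta ub; have := run_subgradient f_cpc run n0 pw pS ub.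
by rewrite /conj_val (active_last_update run n0 aS).
Qed.

Lemma edge_active n (e : edge E) : (0 < n)%N -> e \in En n ->
  exists2 w, (0 < w <= wbar)%N & inl e \in S n w.
Proof. by move=> n0; rewrite En_covered // => /in_bigcup_nat. Qed.

(** An active edge has a finite indicator value, hence 0; an inactive one keeps its zero component
    from the restart onwards. *)
Lemma edge_primal_val n (e : edge E) : (0 < n)%N -> primal_val n (inl e) = 0.
Proof.
move=> n0; have [eE|eE] := boolP (e \in En n).
  have := active_primal_val n0 (edge_active n0 eE).
  by rewrite /= /indicator; case: ifP => // _ [].
suff z0 : z n wbar (inl e) = 0.
  by rewrite /primal_val /conj_val (edge_conj0 f_cpc run) // z0 ipV0r subrr.
suff H w : (w <= wbar)%N -> z n w (inl e) = 0 by exact: H.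
elim: w => [_|w IH ww]; first exact: run_restart_zero run n e n0 eE.
rewrite (run_block_keep run n0 (w := w.+1)) //; first by apply: IH; exact: ltnW.
by apply: contra eE; apply: (run_block_sub run n0 (w := w.+1)).
Qed.

(** The move from the last update to the end of the cycle is at most the drift, which vanishes
    because the dual increments do. *)
Lemma iterate_last_update_cvg a :
  norm_cvg ip (fun k => x_ (nk k) (p_ (nk k) a)) xstar.
Proof.
have [_ _ vcvg _] := good.
apply: norm_cvgD (norm_cvgN x0 vcvg) _.
have [P DP] := dual_bound.
have b0 := ascent_increment_cvg0 cycle_move_ge0 DP dual_step.
have b0k : (fun k => cycle_move (nk k)) @ \oo --> (0 : R).
  by move=> U /b0; exact: (near_subseq (P := fun n => U (cycle_move n))).
have s0 : (fun k => wbar%:R * Num.sqrt (cycle_move (nk k))) @ \oo --> (0 : R).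
  rewrite -(mulr0 wbar%:R); apply: cvgMl_tmp; rewrite -sqrtr0.
  by apply: continuous_cvg b0k; exact: sqrt_continuous.
apply: (squeeze_cvgr _ (cvg_cst 0) s0); apply: nearW => k.
rewrite normV_ge0 /=.
have -> : x_ (nk k) (p_ (nk k) a) - (x0 - v_ (nk k) wbar) =
    v_ (nk k) wbar - v_ (nk k) (p_ (nk k) a).
  by rewrite /iterate opprB addrC addrA subrK.
by apply: drift_le_cycle_move; case/andP: (last_update_bounds S (run_wbar run) (nk k) a).
Qed.

(* An edge violated by the limit is eventually inactive, although no edge need
   stay active; so some connecting [En (nk N)] has only satisfied edges. *)
Lemma limit_consensus (e : edge E) : edge_space e xstar.
Proof.
have ev (e' : edge E) : \forall k \near \oo,
    e' \in En (nk k) -> edge_space e' xstar.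
  have [es|es] := pselect (edge_space e' xstar); first exact: nearW.
  have [_ _ lsc _] := f_cpc (inl e').
  have h0 : (0%:E < summand f (inl e' : dual_index E) xstar)%E.
    by rewrite /= indicator_out // ltry.
  apply: filterS (lsc _ _ _ (iterate_last_update_cvg (inl e')) h0) => k + eE.
  rewrite (active_primal_val (nk_gt0 k) (edge_active (nk_gt0 k) eE)).
  by rewrite edge_primal_val // ltxx.
have [N _ NP] := filter_forall _ ev.
have conn := run_connects run (nk_gt0 N).
have xE i j : xstar i = xstar j.
  have /connectP[q] := conn i j.
  elim: q i => [|k q IH] i /=; first by move=> _ ->.
  move=> /andP[/existsP[e' /andP[eN /eqP eik]] /IH/[apply] <-].
  have := NP N (leqnn N) e' eN; apply; rewrite eik !inE eqxx ?orbT //.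
by move=> i j _ _; exact: xE.
Qed.

(** Expand the square of [x0] as iterate plus [vA], and write the iterate at each last update as the
    final one plus the drift; the correction is the sum that vanishes along a good subsequence. *)
Lemma dual_val_split n : (0 < n)%N -> D n = 2^-1 * normV ip (v_ n wbar) ^+ 2 +
  \sum_a primal_val n a - \sum_a '[v_ n wbar - v_ n (p_ n a), z n wbar a].
Proof.
move=> n0; rewrite /primal_val sumrB /dual_val.
have -> : \sum_a '[x_ n (p_ n a), z n wbar a] =
    '[x_ n wbar, v_ n wbar] + \sum_a '[v_ n wbar - v_ n (p_ n a), z n wbar a].
  rewrite {1}vA_sum ipV_sumr -big_split; apply: eq_bigr => a _ /=.
  by rewrite -ipVDl /iterate addrA subrK.
have -> : v_ n wbar = x0 - x_ n wbar by rewrite /iterate subKr.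
by rewrite normV_sqrB ipVDr ipVNr -normV_sqr (ipVC ip x0); lra.
Qed.

(** Semicontinuity along the subsequence bounds the sum of the [r a] from above through the dual
    limit; weak duality at [xstar] gives the reverse inequality. *)
Lemma strong_duality : exists2 r : dual_index E -> R,
  forall a, summand f a xstar = (r a)%:E &
  (fun n => D n) @ \oo --> 2^-1 * normV ip vstar ^+ 2 + \sum_a r a.
Proof.
have [_ _ vcvg ipcvg] := good.
have [P DP] := dual_bound.
have [L DL] := ascent_cvg cycle_move_ge0 DP dual_step.
have vk : (fun k => 2^-1 * normV ip (v_ (nk k) wbar) ^+ 2) @ \oo -->
    2^-1 * normV ip vstar ^+ 2.
  have := cvg_normV_sub (y := 0) vcvg; rewrite subr0 => nv.
  have -> : (fun k => 2^-1 * normV ip (v_ (nk k) wbar) ^+ 2) =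
      (fun k => 2^-1 * (normV ip (v_ (nk k) wbar - 0) * normV ip (v_ (nk k) wbar - 0))).
    by apply/funext => k; rewrite subr0.
  by apply: cvgMl_tmp; exact: cvgM.
have epsk : (fun k => \sum_a '[v_ (nk k) wbar - v_ (nk k) (p_ (nk k) a),
    z (nk k) wbar a]) @ \oo --> (0 : R).
  have z0 : \sum_(a : dual_index E) 0 = 0 :> R by exact: big1.
  rewrite -[X in _ --> X]z0.
  by apply: cvg_sumr => a; exact: ipcvg.
have Dk : (fun k => D (nk k)) @ \oo --> L.
  by move=> U /DL; exact: (near_subseq (P := fun n => U (D n))).
have [r rE rL] : exists2 r : dual_index E -> R,
    forall a, summand f a xstar = (r a)%:E &
    \sum_a r a <= L - 2^-1 * normV ip vstar ^+ 2.
  apply: sum_lt_bound => [a|c cP]; first by case: (f_cpc a) => ->.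
  have ev a : \forall k \near \oo, c a <= primal_val (nk k) a.
    (* An edge may be inactive along the subsequence, so its value at the limit comes from
       [limit_consensus] rather than from semicontinuity. *)
    case: a => [e|i].
      apply: nearW => k; rewrite edge_primal_val //.
      have := cP (inl e); rewrite /= indicator_in; last exact: limit_consensus.
      by rewrite lte_fin => /ltW.
    have [_ _ lsc _] := f_cpc (inr i).
    apply: filterS (lsc _ _ _ (iterate_last_update_cvg (inr i)) (cP (inr i))) => k.
    rewrite (active_primal_val (nk_gt0 k) (vertex_active V_covered i (nk_gt0 k))).
    by rewrite lte_fin => /ltW.
  rewrite -[leRHS]addr0; apply: (cvgr_to_ge (cvgD (cvgB Dk vk) epsk)).
  apply: filterS (filter_forall _ ev) => k ck.
  apply: (@le_trans _ _ (\sum_a primal_val (nk k) a)).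
    by apply: ler_sum => a _; exact: ck.
  suff : \sum_a primal_val (nk k) a <=
      D (nk k) - 2^-1 * normV ip (v_ (nk k) wbar) ^+ 2 +
      \sum_a '[v_ (nk k) wbar - v_ (nk k) (p_ (nk k) a), z (nk k) wbar a] by [].
  by rewrite dual_val_split //; lra.
exists r => //.
have Dle n : (0 < n)%N -> D n <= 2^-1 * normV ip vstar ^+ 2 + \sum_a r a.
  move=> n0; have := duality_gap x0 (conj_fin_last n0) rE.
  rewrite (_ : xstar - x0 = - vstar) ?normVN; last by rewrite addrAC subrr sub0r.
  by apply: le_trans; rewrite lerDl mulr_ge0 ?invr_ge0 ?sqr_ge0.
have LE : L = 2^-1 * normV ip vstar ^+ 2 + \sum_a r a.
  apply/eqP; rewrite eq_le; apply/andP; split; last by move: rL; lra.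
  by apply: (cvgr_to_le DL); exists 1%N => // n /= n0; exact: Dle.
by rewrite -LE.
Qed.

(** The duality gap at [y] passes to the limit along [nk], where strong duality turns the dual
    values into the primal value at [xstar]. The quadratic term yields uniqueness of the
    minimizer. *)
Lemma primal_quadratic_growth (y : XV) :
  (primal ip E f x0 xstar + (2^-1 * normV ip (xstar - y) ^+ 2)%:E <=
   primal ip E f x0 y)%E.
Proof.
have [r rE DL] := strong_duality.
have [_ _ vcvg _] := good.
rewrite {1}/primal /hsum (eq_bigr _ (fun a _ => rE a)) sumEFin -!EFinD.
rewrite (_ : xstar - x0 = - vstar) ?normVN; last by rewrite addrAC subrr sub0r.
have [yfin|] := pselect (forall a : dual_index E, (summand f a y < +oo)%E); last first.
  move=> /existsNP[a /negP]; rewrite ltey negbK => /eqP ya.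
  rewrite /primal /hsum [in leRHS](bigD1 a) //= ya addye ?addey ?leey //.
  rewrite esum_eqNy; apply/existsPn => b; rewrite negb_and.
  by case: (f_cpc b) => ->; rewrite orbT.
have yE (a : dual_index E) : summand f a y = (fine (summand f a y))%:E.
  by rewrite fineK // fin_numE; case: (f_cpc a) => -> _ _ _ /=; rewrite -ltey.
rewrite /primal /hsum (eq_bigr _ (fun a _ => yE a)) sumEFin -!EFinD lee_fin.
have Dk : (fun k => D (nk k)) @ \oo --> 2^-1 * normV ip vstar ^+ 2 + \sum_a r a.
  by move=> U /DL; exact: (near_subseq (P := fun n => U (D n))).
have xk := cvg_normV_sub (y := y) (norm_cvgN x0 vcvg).
apply: (cvgr_to_le (cvgD Dk (cvgMl_tmp (a := 2^-1) (cvgM xk xk)))).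
apply: nearW => k.
by have := duality_gap x0 (conj_fin_last (nk_gt0 k)) yE; rewrite /iterate expr2.
Qed.

Lemma limit_is_the_minimizer : is_the_minimizer (primal ip E f x0) xstar.
Proof.
split=> [y|y ymin].
  apply: le_trans (primal_quadratic_growth y); rewrite leeDl // lee_fin.
  by rewrite mulr_ge0 ?invr_ge0 ?sqr_ge0.
have [r rE _] := strong_duality.
have := le_trans (primal_quadratic_growth y) (ymin xstar).
rewrite /primal /hsum (eq_bigr _ (fun a _ => rE a)) sumEFin -!EFinD lee_fin.
rewrite gerDl pmulr_rle0 ?invr_gt0 // normV_sqr => le0.
apply/eqP; rewrite eq_sym -subr_eq0; apply/eqP/(ipVxx_eq0 (ip := ip))/eqP.
by rewrite eq_le le0 ipVxx_ge0.
Qed.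

Lemma dualF_subseq_cvg : (fun k => dualF ip f x0 (z (nk k) wbar)) @ \oo -->
  ((2^-1 * normV ip vstar ^+ 2)%:E + hsum E f xstar)%E.
Proof.
have [r rE DL] := strong_duality.
rewrite /hsum (eq_bigr _ (fun a _ => rE a)) sumEFin -EFinD.
under eq_cvg do rewrite (dualF_fin x0 (conj_fin_last (nk_gt0 _))).
apply: cvg_EFin; first exact: nearW.
by move=> U /DL; exact: (near_subseq (P := fun n => U (D n))).
Qed.

(** The dual values converge along the full sequence, so the gap at [xstar] controls every iterate
    and not only those of the subsequence. *)
Lemma iterate_cvg : norm_cvg ip (fun n => x_ n wbar) xstar.
Proof.
have [r rE DL] := strong_duality.
apply: near_norm_cvg => e e0.
have e20 : 0 < e ^+ 2 / 2 by rewrite divr_gt0 // exprn_gt0.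
move/cvgrPdist_lt: DL => /(_ _ e20)[N _ NP].
exists N.+1 => // n /= Nn; have n0 : (0 < n)%N by apply: leq_ltn_trans Nn.
rewrite -ler_sqr ?nnegrE ?normV_ge0 ?ltW //.
have := duality_gap x0 (conj_fin_last n0) rE.
rewrite (_ : xstar - x0 = - vstar) ?normVN; last by rewrite addrAC subrr sub0r.
have := le_lt_trans (ler_norm _) (NP n (ltnW Nn)); lra.
Qed.

End Limit.

End Convergence.

(** The last clause ranges over all good subsequences, so it applies in particular to the one that
    the third clause provides. *)
Theorem theorem2p14 (R : realType) (X : finDimNormedType R)
    (ip : {dot X for idfun}) (ip_norm : induces_norm ip)
    (V : finType) (E : {set {set V}}) (E_simple : simple_graph E)
    (E_connected : connects [set: edge E]%SET)
    (f : V -> X -> \bar R) (f_closed_convex : forall i, closed_convex (f i))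
    (x0 : {ffun V -> X})
    (feasible : exists xhat : X, forall i, (f i xhat < +oo)%E)
    (C1 : R) (C1_spec : decomposition_constant ip E C1)
    (wbar : nat) (vH0 : nat -> {ffun V -> X})
    (z : nat -> nat -> dual_index E -> {ffun V -> X})
    (En : nat -> {set edge E}) (S : nat -> nat -> {set dual_index E})
    (run : dykstra_run ip f x0 C1 wbar vH0 z En S)
    (En_covered : forall n, (0 < n)%N -> forall e : edge E,
       (e \in En n) = (inl e \in (\bigcup_(1 <= w < wbar.+1) S n w)%SET))
    (V_covered : forall n, (0 < n)%N -> forall i : V,
       inr i \in (\bigcup_(1 <= w < wbar.+1) S n w)%SET)
    (A B : R)
    (growth : forall n, (0 < n)%N ->
       \sum_(a : dual_index E) normV ip (z n wbar a) <= A * Num.sqrt n%:R + B) :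
  [/\ (\sum_(1 <= n <oo) (\sum_(1 <= w < wbar.+1)
          (normV ip (vA z n w - vA z n w.-1) ^+ 2))%R%:E < +oo)%E /\
        (forall m n, (0 < m)%N -> (m <= n)%N ->
          (dualF ip f x0 (z m wbar) <= dualF ip f x0 (z n wbar))%E),
      exists C : R, forall n w, (0 < n)%N -> (0 < w <= wbar)%N ->
        normV ip (vA z n w) ^+ 2 <= C,
      exists (nk : nat -> nat) (vstar : {ffun V -> X}),
        good_subsequence ip S wbar z nk vstar &
      forall (nk : nat -> nat) (vstar : {ffun V -> X}),
        good_subsequence ip S wbar z nk vstar ->
        [/\ is_the_minimizer (primal ip E f x0) (x0 - vstar),
            (fun k => dualF ip f x0 (z (nk k) wbar)) @ \oo -->
              ((2^-1 * normV ip vstar ^+ 2)%:E + hsum E f (x0 - vstar)%R)%E &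
            norm_cvg ip (fun n => iterate x0 z n wbar) (x0 - vstar)]].
Proof.
have f_cpc := summand_cpc ip_norm (E := E) f_closed_convex feasible.
split.
- split; first exact: (cycle_move_series_lt_pinfty f_cpc feasible run V_covered).
  by move=> m n; exact: (dualF_nondecreasing f_cpc run V_covered).
- have [C CP] := vA_bounded f_cpc feasible run V_covered.
  by exists C => n w n0 /andP[_ ww]; exact: CP.
- have [nk [vstar good]] :=
    good_subsequence_exists f_cpc feasible run V_covered growth.
  by exists nk, vstar.
move=> nk vstar good; split.
- exact: (limit_is_the_minimizer f_cpc feasible run En_covered V_covered good).
- exact: (dualF_subseq_cvg f_cpc feasible run En_covered V_covered good).
- exact: (iterate_cvg f_cpc feasible run En_covered V_covered good).
Qed.
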